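(* In the case $n=3$, and under the identification $\overline{T^*(\mathrm{SL}_3/U)}=\overline{\mathcal{O}}_{\min}\subset\mathfrak{so}_8$ induced by $F$, the quasi-classical Gelfand–Graev action (of the Weyl group $W\cong S_3$ on $\overline{T^*(\mathrm{SL}_3/U)}$) coincides with the triality $S_3$-action $\mathsf{act}$ on $\mathfrak{so}_8$ restricted to $\overline{\mathcal{O}}_{\min}$.
   Context: All varieties are over $\mathbb{C}$. 1. Affine closure as a quotient. $U\subset\mathrm{SL}_3(\mathbb{C})$ is the group of upper triangular unipotent matrices, $\overline{T^*(\mathrm{SL}_3/U)}:=\operatorname{Spec}\mathbb{C}[T^*(\mathrm{SL}_3/U)]$. Let $V=\operatorname{Hom}(\mathbb{C},\mathbb{C}^2)\oplus\operatorname{Hom}(\mathbb{C}^2,\mathbb{C}^3)$ and let $T^*V$ be the space of tuples $B=(\alpha,\beta)=(\alpha_1,\alpha_2,\beta_1,\beta_2)$, $\alpha_k\in\operatorname{Hom}(\mathbb{C}^k,\mathbb{C}^{k+1})$, $\beta_k\in\operatorname{Hom}(\mathbb{C}^{k+1},\mathbb{C}^k)$. $\mathrm{SL}_2$ acts by $g\cdot(\alpha_1,\alpha_2,\beta_1,\beta_2)=(g\alpha_1,\alpha_2g^{-1},\beta_1g^{-1},g\beta_2)$. Let $N\subset T^*V$ be the zero fiber of its moment map, i.e. the set of $(\alpha,\beta)$ for which there is a scalar $\lambda_2$ with $\beta_2\alpha_2-\alpha_1\beta_1=\lambda_2\mathrm{Id}_{\mathbb{C}^2}$; also put $\lambda_1=\beta_1\alpha_1$.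 Let $\pi:N\to N/\!\!/\mathrm{SL}_2=\operatorname{Spec}\mathbb{C}[N]^{\mathrm{SL}_2}$. By a theorem of Dancer–Kirwan–Swann, $\overline{T^*(\mathrm{SL}_3/U)}\cong N/\!\!/\mathrm{SL}_2$. 2. Gelfand–Graev action (in Wang's description). Set $\alpha_0=0$, $\beta_0=0$, $\mathbb{C}^0=0$. For $k\in\{1,2\}$ put $\mathrm{out}_k(B)=\alpha_k\oplus\beta_{k-1}\in\operatorname{Hom}(\mathbb{C}^k,\mathbb{C}^{k+1}\oplus\mathbb{C}^{k-1})$ and $\mathrm{in}_k(B)=\beta_k\oplus(-\alpha_{k-1})\in\operatorname{Hom}(\mathbb{C}^{k+1}\oplus\mathbb{C}^{k-1},\mathbb{C}^k)$. For each $j$ fix some volume form $\mathrm{vol}_j\in\bigwedge^j\mathbb{C}^j$. Let $Z_k\subset N\times N$ be the set of pairs $(B,B')=((\alpha,\beta),(\alpha',\beta'))$ such that: (1) $\alpha_j=\alpha_j'$, $\beta_j=\beta_j'$ for all $j\notin\{k-1,k\}$; (2) the sequence $0\to\mathbb{C}^k\xrightarrow{\mathrm{out}_k(B')}\mathbb{C}^{k+1}\oplus\mathbb{C}^{k-1}\xrightarrow{\mathrm{in}_k(B)}\mathbb{C}^k\to0$ is exact, and $\mathrm{out}_k(B')(\mathrm{vol}_k)\wedge\mathrm{in}_k(B)^{-1}(\mathrm{vol}_k)=\mathrm{vol}_{k-1}\wedge\mathrm{vol}_{k+1}$ in $\bigwedge^{2k}(\mathbb{C}^{k+1}\oplus\mathbb{C}^{k-1})$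 (where any element of $\mathrm{in}_k(B)^{-1}(\mathrm{vol}_k)$ may be taken); (3) $\mathrm{out}_k(B')\,\mathrm{in}_k(B')=\mathrm{out}_k(B)\,\mathrm{in}_k(B)-\lambda_k\mathrm{Id}_{\mathbb{C}^{k+1}\oplus\mathbb{C}^{k-1}}$. By a theorem of Wang, for each simple reflection $s_k\in W$ one can construct an automorphism $S_k$ of $N/\!\!/\mathrm{SL}_2$ such that $S_k(\pi(B))=\pi(B')$ for all $(B,B')\in Z_k$; the $S_k$ satisfy the braid relations, and the resulting $W$-action on $N/\!\!/\mathrm{SL}_2$ coincides with the quasi-classical Gelfand–Graev action on $\overline{T^*(\mathrm{SL}_3/U)}$. The Weyl group $W$ is identified with $S_3$ by $s_1=(23)$, $s_2=(13)$. 3. The identification with $\overline{\mathcal{O}}_{\min}$. Equip $\mathbb{C}^8$ (standard basis $e_1,\dots,e_8$) with the symmetric bilinear form $(e_i,e_j)=\delta_{i,9-j}$, and identify $\bigwedge^2\mathbb{C}^8=\mathfrak{so}_8$ by letting $v_1\wedge v_2$ act as $u\mapsto(v_1,u)v_2-(v_2,u)v_1$. $\mathcal{O}_{\min}\subset\mathfrak{so}_8$ is the nonzero nilpotent adjoint orbit of minimal dimension, $\overline{\mathcal{O}}_{\min}=\mathcal{O}_{\min}\cup\{0\}$. Define $F:T^*V\to\operatorname{Hom}(\mathbb{C}^2,\mathbb{C}^4\oplus(\mathbb{C}^4)^* )$, with $\mathbb{C}^4=\mathbb{C}^3\oplus\mathbb{C}$, by $$F(\alpha,\beta)(v)=(\alpha_2\oplus-\beta_1)(v)\oplus\frac{(\beta_2\oplus\alpha_1)\wedge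 v}{e_1\wedge e_2},$$ where the second component is the functional $x\mapsto((\beta_2\oplus\alpha_1)(x)\wedge v)/(e_1\wedge e_2)$ on $\mathbb{C}^4$; identify $\mathbb{C}^4\oplus(\mathbb{C}^4)^*=\mathbb{C}^3\oplus\mathbb{C}\oplus\mathbb{C}^*\oplus(\mathbb{C}^3)^*$ (with $\mathbb{C}^*$ the dual of $\mathbb{C}$) with $\mathbb{C}^8$ by $\eta(z_1,z_2,z_3,a,b,w_1,w_2,w_3)=z_1e_2+z_2e_3-z_3e_8+ae_4+be_5-w_3e_1+w_2e_6+w_1e_7$. The map $(\alpha,\beta)\mapsto F(\alpha,\beta)(e_1)\wedge F(\alpha,\beta)(e_2)$ induces an isomorphism $N/\!\!/\mathrm{SL}_2\to\overline{\mathcal{O}}_{\min}$, which is the identification used. 4. The action $\mathsf{act}$ of $S_3$ on $\mathfrak{so}_8=\bigwedge^2\mathbb{C}^8$. Write $H_i=e_i\wedge e_{9-i}$, $i=1,\dots,4$. Decompose $\mathfrak{so}_8=L\oplus\varphi_2(\mathfrak{h})\oplus V_1\oplus V_2\oplus V_3\oplus V_1^*\oplus V_2^*\oplus V_3^*$, where: $L\cong\mathfrak{sl}_3$ is spanned by $e_2\wedge e_6,\ e_1\wedge e_3,\ e_1\wedge e_2,\ e_3\wedge e_7,\ e_6\wedge e_8,\ e_7\wedge e_8,\ H_2-H_3,\ H_1+H_3$; $\mathfrak{h}=\{(c_1,c_2,c_3)\in\mathbb{C}^3:c_1+c_2+c_3=0\}$ and $\varphi_2(c)=c_1(H_1-H_2)+c_2(H_3-H_4)+c_3(H_3+H_4)$;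 and the spaces $V_i\cong\mathbb{C}^3$, $V_i^*\cong(\mathbb{C}^3)^*$ have the ordered bases $V_1:(-e_1\wedge e_6,\ e_1\wedge e_7,\ e_6\wedge e_7)$, $V_2:(e_2\wedge e_5,\ e_3\wedge e_5,\ e_5\wedge e_8)$, $V_3:(e_2\wedge e_4,\ e_3\wedge e_4,\ e_4\wedge e_8)$, $V_1^*:(e_2\wedge e_3,\ e_2\wedge e_8,\ -e_3\wedge e_8)$, $V_2^*:(e_1\wedge e_4,\ e_4\wedge e_6,\ e_4\wedge e_7)$, $V_3^*:(e_1\wedge e_5,\ e_5\wedge e_6,\ e_5\wedge e_7)$. For $\sigma\in S_3$, $\mathsf{act}(\sigma)$ is the linear map fixing $L$ pointwise, acting on $\mathfrak{h}$ as the Weyl group $S_3$ (permuting the coordinates $c_1,c_2,c_3$), and permuting the subscripts of the $V_i$ and of the $V_i^*$, i.e. sending $V_i\to V_{\sigma(i)}$, $V_i^*\to V^*_{\sigma(i)}$ by matching the ordered bases. This is the triality action of $S_3$ on $\mathfrak{so}_8$ by Lie algebra automorphisms, hence it preserves $\overline{\mathcal{O}}_{\min}$.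
   Formalization: The volume forms vol_j are not arbitrary: writing vol_j as a scalar times e_1∧…∧e_j, one requires vol_{k-1}vol_{k+1} = -vol_k^2 for k=1,2; for other choices (e.g. vol_j = e_1∧…∧e_j) S_k is a torus twist of act(s_k) and the claim fails. *)

(* Defs.v *)
From HB Require Import structures.
From mathcomp Require Import all_boot all_order all_algebra all_fingroup.
From mathcomp Require Import boolp classical_sets functions.
From mathcomp Require Import reals.
From mathcomp Require Import complex.
From mathcomp Require Import mpoly.
From mathcomp Require Import ring.

Set Implicit Arguments.
Unset Strict Implicit.
Unset Printing Implicit Defensive.

Import GRing.Theory Num.Theory.
Local Open Scope classical_set_scope.
Local Open Scope ring_scope.

(* The complex numbers are R[i] for R : realType; a linear map C^m -> C^n is
   an n x m matrix acting on column vectors. *)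

Record TV (R : realType) := MkTV {
  alpha1 : 'M[R[i]]_(2, 1);
  alpha2 : 'M[R[i]]_(3, 2);
  beta1 : 'M[R[i]]_(1, 2);
  beta2 : 'M[R[i]]_(2, 3) }.

Section ZeroFibre.
Variable R : realType.
Notation C := (R[i]).

Definition sl2_act (g : 'M[C]_2) (B : TV R) : TV R :=
  MkTV (g *m alpha1 B) (alpha2 B *m invmx g)
       (beta1 B *m invmx g) (g *m beta2 B).

Definition moment (B : TV R) : 'M[C]_2 :=
  beta2 B *m alpha2 B - alpha1 B *m beta1 B.

Definition inN (B : TV R) : Prop := exists lam : C, moment B = lam%:M.

Record N := MkN { valN :> TV R; valNP : inN valN }.

Lemma inN0 : inN (MkTV 0 0 0 0).
Proof. by exists 0; rewrite /moment /= !mul0mx subr0 raddf0. Qed.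

HB.instance Definition _ := gen_eqMixin N.
HB.instance Definition _ := gen_choiceMixin N.
HB.instance Definition _ := isPointed.Build N (MkN inN0).

Lemma fctN_scalerAl (a : C) (f g : N -> C) : a *: (f * g) = (a *: f) * g.
Proof. by apply/funext => B; exact: mulrA. Qed.

HB.instance Definition _ :=
  GRing.Lmodule_isLalgebra.Build C (N -> C) fctN_scalerAl.
HB.instance Definition _ := GRing.Lalgebra_isComAlgebra.Build C (N -> C).

Definition dimTV := ((2 * 1 + 3 * 2) + (1 * 2 + 2 * 3))%N.

Definition coordTV (B : TV R) : 'rV[C]_dimTV :=
  row_mx (row_mx (mxvec (alpha1 B)) (mxvec (alpha2 B)))
         (row_mx (mxvec (beta1 B)) (mxvec (beta2 B))).

Definition regular (f : N -> C) : Prop :=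
  exists p : {mpoly C[dimTV]}, forall B : N, f B = p.@[coordTV B 0].

Definition sl2_invariant (f : N -> C) : Prop :=
  forall (g : 'M[C]_2) (B B' : N),
    \det g = 1 -> B' = sl2_act g B :> TV R -> f B' = f B.

Definition CN_SL2_pred : {pred N -> C} :=
  fun f => `[< regular f /\ sl2_invariant f >].

Lemma CN_SL2_subalg : GRing.subalg_closed CN_SL2_pred.
Proof.
split.
- apply/asboolP; split; first by exists 1 => B; rewrite meval1.
  by [].
- move=> a f g /asboolP[[p fp] fi] /asboolP[[q gq] gi]; apply/asboolP; split.
    by exists (a *: p + q) => B; rewrite mevalD mevalZ -fp -gq.
  move=> s B B' d e; rewrite addrfctE -![(a *: f) _]/(a * f _).
  by rewrite (fi _ _ _ d e) (gi _ _ _ d e).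
- move=> f g /asboolP[[p fp] fi] /asboolP[[q gq] gi]; apply/asboolP; split.
    by exists (p * q) => B; rewrite mevalM -fp -gq.
  by move=> s B B' d e; rewrite !mulrfctE (fi _ _ _ d e) (gi _ _ _ d e).
Qed.

HB.instance Definition _ :=
  GRing.isSubalgClosed.Build C (N -> C) CN_SL2_pred CN_SL2_subalg.

Record CN_SL2 := MkCN_SL2 {
  fun_of_CN :> N -> C;
  fun_of_CNP : fun_of_CN \in CN_SL2_pred }.

HB.instance Definition _ := [isSub for fun_of_CN].
HB.instance Definition _ := [Choice of CN_SL2 by <:].
HB.instance Definition _ := [SubChoice_isSubComNzRing of CN_SL2 by <:].
HB.instance Definition _ := [SubZmodule_isSubLmodule of CN_SL2 by <:].
HB.instance Definition _ :=
  [SubNzRing_SubLmodule_isSubLalgebra of CN_SL2 by <:].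
HB.instance Definition _ := [SubLalgebra_isSubAlgebra of CN_SL2 by <:].

(* The closed points of N//SL_2 = Spec C[N]^SL_2 are the C-algebra
   homomorphisms C[N]^SL_2 -> C. *)
Definition quot := {lrmorphism CN_SL2 -> C^o}.

Definition pi_fun (B : N) (f : CN_SL2) : C^o := f B.

Lemma pi_zmod B : {morph pi_fun B : f g / f - g}. Proof. by []. Qed.
Lemma pi_monoid B : monoid_morphism (pi_fun B). Proof. by []. Qed.
Lemma pi_scalable B : scalable (pi_fun B). Proof. by []. Qed.

HB.instance Definition _ B :=
  GRing.isZmodMorphism.Build CN_SL2 C^o (pi_fun B) (@pi_zmod B).
HB.instance Definition _ B :=
  GRing.isMonoidMorphism.Build CN_SL2 C^o (pi_fun B) (@pi_monoid B).
HB.instance Definition _ B :=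
  GRing.isScalable.Build C CN_SL2 C^o *:%R (pi_fun B) (@pi_scalable B).

Definition pi (B : N) : quot := pi_fun B.

Definition quot_morphism (S : quot -> quot) : Prop :=
  exists phi : {lrmorphism CN_SL2 -> CN_SL2}, forall x f, S x f = x (phi f).

End ZeroFibre.

Section Orthogonal.
Variable R : realType.
Notation C := (R[i]).

(* e_k with the 1-based numbering of the standard basis *)
Definition e8 (k : nat) : 'cV[C]_8 := delta_mx (inord k.-1) 0.

Definition form8 : 'M[C]_8 := \matrix_(i, j) ((i + j == 7)%N)%:R.

Definition bil8 (u v : 'cV[C]_8) : C := (u^T *m form8 *m v) 0 0.

(* the matrix of u |-> (v1, u) v2 - (v2, u) v1 *)
Definition wedge (v1 v2 : 'cV[C]_8) : 'M[C]_8 :=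
  v2 *m (v1^T *m form8) - v1 *m (v2^T *m form8).

Lemma wedgeE v1 v2 u :
  wedge v1 v2 *m u = bil8 v1 u *: v2 - bil8 v2 u *: v1.
Proof.
have h (w w' : 'cV[C]_8) : w' *m (w^T *m form8) *m u = bil8 w u *: w'.
  rewrite -mulmxA [_ *m u]mx11_scalar; apply/matrixP => i j.
  by rewrite mul_mx_scalar !mxE.
by rewrite mulmxBl !h.
Qed.

Definition so8 : set 'M[C]_8 := [set x | x^T *m form8 + form8 *m x = 0].

Definition SO8 : set 'M[C]_8 :=
  [set g | g^T *m form8 *m g = form8 /\ \det g = 1].

Definition adj_orbit (x : 'M[C]_8) : set 'M[C]_8 :=
  [set g *m x *m invmx g | g in SO8].

Definition nilpotent8 (x : 'M[C]_8) : Prop := exists k, x ^+ k = 0.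

(* Dimension is the Krull dimension of the Zariski topology. *)
Definition zariski_closed (Z : set 'M[C]_8) : Prop :=
  exists I : set {mpoly C[8 * 8]},
    Z = [set x | forall p, I p -> p.@[mxvec x 0] = 0].

Definition closed_in (O Z : set 'M[C]_8) : Prop :=
  exists2 Y, zariski_closed Y & Z = O `&` Y.

Definition irreducible_closed_in (O Z : set 'M[C]_8) : Prop :=
  [/\ closed_in O Z, Z !=set0 &
      forall Y1 Y2, closed_in O Y1 -> closed_in O Y2 ->
        Z `<=` Y1 `|` Y2 -> Z `<=` Y1 \/ Z `<=` Y2].

Definition dim_ge (O : set 'M[C]_8) (n : nat) : Prop :=
  exists Z : nat -> set 'M[C]_8,
    (forall i, (i <= n)%N -> irreducible_closed_in O (Z i)) /\
    (forall i, (i < n)%N -> Z i `<` Z i.+1).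

Definition dim_le (O1 O2 : set 'M[C]_8) : Prop :=
  forall n, dim_ge O1 n -> dim_ge O2 n.

Definition nonzero_nilpotent (x : 'M[C]_8) : Prop :=
  [/\ so8 x, x <> 0 & nilpotent8 x].

Definition Omin : set 'M[C]_8 :=
  [set x | nonzero_nilpotent x /\
    forall y, nonzero_nilpotent y -> dim_le (adj_orbit x) (adj_orbit y)].

Definition Ominbar : set 'M[C]_8 := Omin `|` [set 0].

Definition eta (z : 'cV[C]_3) (a b : C) (w : 'rV[C]_3) : 'cV[C]_8 :=
  z 0 0 *: e8 2 + z 1 0 *: e8 3 - z 2 0 *: e8 8 + a *: e8 4 + b *: e8 5
  - w 0 2 *: e8 1 + w 0 1 *: e8 6 + w 0 0 *: e8 7.

(* In C^2, x /\ v divided by e_1 /\ e_2 is the determinant of (x | v); the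
   functionals on C^3 and on C are given by their values on the standard
   basis. *)
Definition F (B : TV R) (v : 'cV[C]_2) : 'cV[C]_8 :=
  eta (alpha2 B *m v) (- (beta1 B *m v) 0 0)
      (\det (row_mx (alpha1 B) v))
      (\row_j \det (row_mx (col j (beta2 B)) v)).

Definition Phi (B : TV R) : 'M[C]_8 :=
  wedge (F B (delta_mx 0 0)) (F B (delta_mx 1 0)).

Lemma det2 (M : 'M[C]_2) : \det M = M 0 0 * M 1 1 - M 0 1 * M 1 0.
Proof.
rewrite (expand_det_row M 0) !big_ord_recl big_ord0 /cofactor !det_mx11 !mxE /=.
rewrite expr0 expr1 addr0 mul1r mulN1r mulrN.
by congr (M _ _ * M _ _ - M _ _ * M _ _); apply: val_inj.
Qed.

Lemma det_row_mx2 (x y : 'cV[C]_2) :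
  \det (row_mx x y) = x 0 0 * y 1 0 - x 1 0 * y 0 0.
Proof.
set M : 'M_2 := row_mx x y.
have M0 i : M i 0 = x i 0.
  by rewrite -[RHS](row_mxEl x y); congr (row_mx x y _ _); apply: val_inj.
have M1 i : M i 1 = y i 0.
  by rewrite -[RHS](row_mxEr x y); congr (row_mx x y _ _); apply: val_inj.
by rewrite det2 !M0 !M1 [X in _ - X]mulrC.
Qed.

Lemma regularD (f g : N R -> C) :
  regular f -> regular g -> regular (fun B => f B + g B).
Proof.
by move=> [p fp] [q gq]; exists (p + q) => B; rewrite mevalD -fp -gq.
Qed.

Lemma regularM (f g : N R -> C) :
  regular f -> regular g -> regular (fun B => f B * g B).
Proof.
by move=> [p fp] [q gq]; exists (p * q) => B; rewrite mevalM -fp -gq.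
Qed.

Lemma regular_cst (c : C) : regular (fun _ : N R => c).
Proof. by exists c%:MP => B; rewrite mevalC. Qed.

Lemma regularN (f : N R -> C) : regular f -> regular (fun B => - f B).
Proof. by move=> [p fp]; exists (- p) => B; rewrite mevalN -fp. Qed.

Lemma regular_sum (I : Type) (s : seq I) (f : I -> N R -> C) :
  (forall i, regular (f i)) -> regular (fun B => \sum_(i <- s) f i B).
Proof.
move=> h; elim: s => [|i s [p hp]].
  by exists 0 => B; rewrite big_nil meval0.
by have [q hq] := h i; exists (q + p) => B; rewrite big_cons mevalD -hq hp.
Qed.

Lemma regular_prod (I : Type) (s : seq I) (f : I -> N R -> C) :
  (forall i, regular (f i)) -> regular (fun B => \prod_(i <- s) f i B).
Proof.
move=> h; elim: s => [|i s [p hp]].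
  by exists 1 => B; rewrite big_nil meval1.
by have [q hq] := h i; exists (q * p) => B; rewrite big_cons mevalM -hq hp.
Qed.

Definition regular_mx m n (A : N R -> 'M[C]_(m, n)) : Prop :=
  forall i j, regular (fun B => A B i j).

Lemma regular_ext (f g : N R -> C) : f =1 g -> regular f -> regular g.
Proof. by move=> e [p fp]; exists p => B; rewrite -e. Qed.

Lemma regular_mulmx m n p (A : N R -> 'M[C]_(m, n)) (D : N R -> 'M[C]_(n, p)) :
  regular_mx A -> regular_mx D -> regular_mx (fun B => A B *m D B).
Proof.
move=> hA hD i j; apply: (@regular_ext (fun B => \sum_k A B i k * D B k j)).
  by move=> B; rewrite mxE.
by apply: regular_sum => k; apply: regularM.
Qed.

Lemma regular_cstmx m n (A : 'M[C]_(m, n)) : regular_mx (fun _ => A).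
Proof. by move=> i j; apply: regular_cst. Qed.

Lemma regular_det2 (A D : N R -> 'cV[C]_2) :
  regular_mx A -> regular_mx D -> regular (fun B => \det (row_mx (A B) (D B))).
Proof.
move=> hA hD; apply: regular_ext (fun B => esym (det_row_mx2 (A B) (D B))) _.
by apply: regularD; [|apply: regularN]; apply: regularM.
Qed.

Lemma regular_entries :
  [/\ regular_mx (fun B : N R => alpha1 B), regular_mx (fun B : N R => alpha2 B),
      regular_mx (fun B : N R => beta1 B) & regular_mx (fun B : N R => beta2 B)].
Proof.
split=> i j; [exists 'X_(lshift _ (lshift _ (mxvec_index i j)))
             |exists 'X_(lshift _ (rshift _ (mxvec_index i j)))
             |exists 'X_(rshift _ (lshift _ (mxvec_index i j)))
             |exists 'X_(rshift _ (rshift _ (mxvec_index i j)))] => B;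
rewrite mevalXU /coordTV ?(row_mxEl, row_mxEr);
by rewrite -[RHS]/(mxvec _ _ _) ?(row_mxEl, row_mxEr) mxvecE.
Qed.

Lemma regular_F v : regular_mx (fun B : N R => F B v).
Proof.
have [h1 h2 h3 h4] := regular_entries.
have hz (c : N R -> C) (e : 'cV[C]_8) i j :
    regular c -> regular (fun B => (c B *: e) i j).
  move=> hc; apply: (@regular_ext (fun B => c B * e i j)).
    by move=> B; rewrite mxE.
  by apply: regularM hc (regular_cst _).
have ha (A D : N R -> 'cV[C]_8) : regular_mx A -> regular_mx D ->
    regular_mx (fun B => A B + D B).
  by move=> hA hD i j; apply: regular_ext (regularD (hA i j) (hD i j)) => B;
    rewrite mxE.
have hn (A : N R -> 'cV[C]_8) : regular_mx A -> regular_mx (fun B => - A B).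
  by move=> hA i j; apply: regular_ext (regularN (hA i j)) => B; rewrite mxE.
have hw j : regular (fun B : N R =>
    (\row_j \det (row_mx (col j (beta2 B)) v) : 'rV[C]_3) 0 j).
  apply: (@regular_ext (fun B : N R => \det (row_mx (col j (beta2 B)) v))).
    by move=> B; rewrite mxE.
  apply: regular_det2 (regular_cstmx v).
  by move=> i k; apply: regular_ext (h4 i j) => B; rewrite mxE.
have hz2 := regular_mulmx h2 (regular_cstmx v).
have hb1 := regularN (regular_mulmx h3 (regular_cstmx v) 0 0).
have hd := regular_det2 h1 (regular_cstmx v).
rewrite /F /eta.
do ?[apply: (ha)]; do ?[apply: (hn)]; move=> i j; apply: (hz) => //.
Qed.

Lemma regular_Phi i j : regular (fun B : N R => Phi B i j).
Proof.
have ht v : regular_mx (fun B : N R => (F B v)^T).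
  by move=> k l; apply: regular_ext (regular_F v l k) => B; rewrite [RHS]mxE.
have hp u v : regular_mx (fun B : N R => F B u *m ((F B v)^T *m form8)).
  apply: regular_mulmx (regular_F u) _.
  exact: regular_mulmx (ht v) (regular_cstmx _).
apply: regular_ext (regularD (hp _ _ i j) (regularN (hp _ _ i j))) => B.
by rewrite /Phi /wedge [in RHS]mxE [X in _ = _ + X]mxE.
Qed.

Lemma F_lin B (v : 'cV[C]_2) :
  F B v = v 0 0 *: F B (delta_mx 0 0) + v 1 0 *: F B (delta_mx 1 0).
Proof.
have hv : v = v 0 0 *: delta_mx 0 0 + v 1 0 *: delta_mx 1 0.
  apply/matrixP => i j; rewrite !mxE ord1.
  by case: i => [[|[|[]]]] //= p; rewrite ?(mulr1, mulr0, addr0, add0r);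
    congr (v _ _); apply: val_inj.
have hd (x : 'cV[C]_2) (s t : C) (u w : 'cV[C]_2) :
    \det (row_mx x (s *: u + t *: w) : 'M_2) =
    s * \det (row_mx x u : 'M_2) + t * \det (row_mx x w : 'M_2).
  by rewrite !det_row_mx2 !mxE; ring.
set s := v 0 0; set t := v 1 0; rewrite [in LHS]hv -/s -/t.
rewrite /F hd !mulmxDr -!scalemxAr.
have -> : \row_j \det (row_mx (col j (beta2 B))
      (s *: delta_mx 0 0 + t *: delta_mx 1 0)) =
    s *: \row_j \det (row_mx (col j (beta2 B)) (delta_mx 0 0)) +
    t *: \row_j \det (row_mx (col j (beta2 B)) (delta_mx 1 0)) :> 'rV[C]_3.
  by apply/rowP => j; rewrite !mxE hd.
rewrite /eta; apply/matrixP => i j; rewrite !mxE; ring.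
Qed.
Lemma wedge_lin (u w : 'cV[C]_8) (a b c d : C) :
  wedge (a *: u + b *: w) (c *: u + d *: w) = (a * d - b * c) *: wedge u w.
Proof.
have [k ek] : {k | k = a * d - b * c} by exists (a * d - b * c).
rewrite -ek /wedge !linearD /= !linearZ /= !(mulmxDl, mulmxDr).
rewrite !(=^~ scalemxAl, =^~ scalemxAr).
set uu := u *m _; set uw := u *m _; set wu := w *m _; set ww := w *m _.
by apply/matrixP => i j; rewrite ek !mxE; ring.
Qed.

Lemma Phi_inv (g : 'M[C]_2) B : \det g = 1 -> Phi (sl2_act g B) = Phi B.
Proof.
move=> dg; have ug : g \in unitmx by rewrite unitmxE dg unitr1.
have dV : \det (invmx g) = 1 by rewrite det_inv dg invr1.
have hd (x v : 'cV[C]_2) :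
    \det (row_mx (g *m x) v) = \det (row_mx x (invmx g *m v)).
  rewrite -[v in LHS](mulKVmx ug) -mul_mx_row.
  by rewrite [LHS](det_mulmx g) dg mul1r.
have hF v : F (sl2_act g B) v = F B (invmx g *m v).
  rewrite /F /= hd -!mulmxA; congr eta; apply/rowP => j; rewrite !mxE.
  by rewrite -hd !colE mulmxA.
rewrite /Phi !hF (F_lin B (invmx g *m delta_mx 0 0)).
rewrite (F_lin B (invmx g *m delta_mx 1 0)) wedge_lin -!colE !mxE.
rewrite [X in X *: _](_ : _ = 1) ?scale1r //.
by rewrite -dV det2; ring.
Qed.

Lemma Phi_CN i j : (fun B : N R => Phi B i j) \in @CN_SL2_pred R.
Proof.
apply/asboolP; split; first exact: regular_Phi.
by move=> g B B' dg ->; rewrite Phi_inv.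
Qed.

(* The morphism N//SL_2 -> Mat_8 induced by Phi: on coordinate rings it maps
   the (i, j) entry to the invariant Phi_ij. *)
Definition ident (x : quot R) : 'M[C]_8 :=
  \matrix_(i, j) x (MkCN_SL2 (Phi_CN i j)).

Lemma ident_pi B : ident (pi B) = Phi B.
Proof. by apply/matrixP => i j; rewrite mxE. Qed.

End Orthogonal.

Section GelfandGraev.
Variable R : realType.
Notation C := (R[i]).
Implicit Types B : TV R.

(* C^{k+1} (+) C^{k-1} has dimension k + k; alpha_0 and beta_0 are the zero
   maps from and to C^0. *)
Definition out1 B : 'M[C]_(1 + 1, 1) :=
  col_mx (alpha1 B : 'M_(2, 1)) (0 : 'M_(0, 1)).
Definition in1 B : 'M[C]_(1, 1 + 1) :=
  row_mx (beta1 B : 'M_(1, 2)) (- 0 : 'M_(1, 0)).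
Definition out2 B : 'M[C]_(2 + 2, 2) :=
  col_mx (alpha2 B : 'M_(3, 2)) (beta1 B : 'M_(1, 2)).
Definition in2 B : 'M[C]_(2, 2 + 2) :=
  row_mx (beta2 B : 'M_(2, 3)) (- alpha1 B : 'M_(2, 1)).

(* On N the 2 x 2 matrix [moment B] is scalar, so lambda2 is that scalar. *)
Definition lambda1 B : C := (beta1 B *m alpha1 B) 0 0.
Definition lambda2 B : C := moment B 0 0.

Definition short_exact k (f : 'M[C]_(k + k, k)) (g : 'M[C]_(k, k + k)) : Prop :=
  [/\ forall u : 'cV_k, f *m u = 0 -> u = 0,
      forall v : 'cV_(k + k), g *m v = 0 <-> exists u : 'cV_k, v = f *m u
    & forall w : 'cV_k, exists v : 'cV_(k + k), g *m v = w].

(* vol j stands for the volume form (vol j) e_1 /\ ... /\ e_j.  The columns of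
   a W with g W = Id lift e_1, ..., e_k, so (vol k) W_1 /\ ... /\ W_k is in the
   preimage of vol_k under g.  The sign compares vol_{k-1} /\ vol_{k+1} with
   the basis of C^{k+1} (+) C^{k-1}, where C^{k+1} comes first. *)
Definition volume_condition (vol : nat -> C) k
    (f : 'M[C]_(k + k, k)) (g : 'M[C]_(k, k + k)) : Prop :=
  forall W : 'M[C]_(k + k, k), g *m W = 1%:M ->
    vol k ^+ 2 * \det (row_mx f W) =
    (-1) ^+ (k.-1 * k.+1) * (vol k.-1 * vol k.+1).

Definition Z1 (vol : nat -> C) (B B' : N R) : Prop :=
  [/\ alpha2 B = alpha2 B' /\ beta2 B = beta2 B',
      short_exact (out1 B') (in1 B),
      volume_condition vol (out1 B') (in1 B)
    & out1 B' *m in1 B' = out1 B *m in1 B - (lambda1 B)%:M].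

Definition Z2 (vol : nat -> C) (B B' : N R) : Prop :=
  [/\ short_exact (out2 B') (in2 B),
      volume_condition vol (out2 B') (in2 B)
    & out2 B' *m in2 B' = out2 B *m in2 B - (lambda2 B)%:M].

(* s_1 = (23) and s_2 = (13), with 0-based indices *)
Definition s1 : 'S_3 := tperm 1 2.
Definition s2 : 'S_3 := tperm 0 2.

(* In 'S_3 the product sigma * tau is "sigma, then tau": the third clause says
   that S is a left action for the usual composition of permutations. *)
Definition GelfandGraev_action (vol : nat -> C)
    (S : 'S_3 -> quot R -> quot R) : Prop :=
  [/\ forall sigma, quot_morphism (S sigma),
      forall x, S 1%g x = x,
      forall sigma tau x, S (sigma * tau)%g x = S tau (S sigma x),
      forall B B' : N R, Z1 vol B B' -> S s1 (pi B) = pi B'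
    & forall B B' : N R, Z2 vol B B' -> S s2 (pi B) = pi B'].

(* Z_k depends on the volume forms: rescaling them twists S_1 and S_2 by torus
   elements.  The action is the triality action (rather than a twist of it)
   exactly when vol_{k-1} vol_{k+1} = - vol_k^2 for k = 1, 2, as for
   vol_j = e_j /\ ... /\ e_1. *)
Definition volume_normalized (vol : nat -> C) : Prop :=
  (forall j, (j <= 3)%N -> vol j != 0) /\
  (forall k, (0 < k < 3)%N -> vol k.-1 * vol k.+1 = - vol k ^+ 2).

Definition ew (i j : nat) : 'M[C]_8 := wedge (e8 R i) (e8 R j).
Definition H (i : nat) : 'M[C]_8 := ew i (9 - i).

Definition L_basis : 8.-tuple 'M[C]_8 :=
  [tuple ew 2 6; ew 1 3; ew 1 2; ew 3 7; ew 6 8; ew 7 8; H 2 - H 3; H 1 + H 3].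

Definition phi2 (c : 'rV[C]_3) : 'M[C]_8 :=
  c 0 0 *: (H 1 - H 2) + c 0 1 *: (H 3 - H 4) + c 0 2 *: (H 3 + H 4).

Definition h_basis : 2.-tuple 'rV[C]_3 :=
  [tuple delta_mx 0 0 - delta_mx 0 1; delta_mx 0 1 - delta_mx 0 2].

(* the coordinate c_i moves to position sigma(i) *)
Definition h_act (sigma : 'S_3) (c : 'rV[C]_3) : 'rV[C]_3 :=
  \row_i c 0 ((sigma^-1)%g i).

Definition V_basis (i : 'I_3) : 3.-tuple 'M[C]_8 :=
  tnth [tuple [tuple - ew 1 6; ew 1 7; ew 6 7];
              [tuple ew 2 5; ew 3 5; ew 5 8];
              [tuple ew 2 4; ew 3 4; ew 4 8]] i.

Definition Vdual_basis (i : 'I_3) : 3.-tuple 'M[C]_8 :=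
  tnth [tuple [tuple ew 2 3; ew 2 8; - ew 3 8];
              [tuple ew 1 4; ew 4 6; ew 4 7];
              [tuple ew 1 5; ew 5 6; ew 5 7]] i.

(* so8_frame 1 is a basis of so_8, and so8_frame sigma lists the images of
   its members under the action of sigma. *)
Definition so8_frame (sigma : 'S_3) :=
  [tuple of L_basis ++ map_tuple (phi2 \o h_act sigma) h_basis
    ++ (V_basis (sigma 0) ++ V_basis (sigma 1) ++ V_basis (sigma 2))
    ++ (Vdual_basis (sigma 0) ++ Vdual_basis (sigma 1)
        ++ Vdual_basis (sigma 2))].

(* the linear map on so_8 with these values on the basis *)
Definition triality_act (sigma : 'S_3) (x : 'M[C]_8) : 'M[C]_8 :=
  \sum_k coord (so8_frame 1%g) k x *: (so8_frame sigma)`_k.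

Definition inverse_identification (j : 'M[C]_8 -> quot R) : Prop :=
  (forall x, Ominbar (ident x) /\ j (ident x) = x) /\
  (forall y, Ominbar y -> ident (j y) = y).

End GelfandGraev.

(* Main.v *)
(* Two closed computations carry the proof.  On an open subset of N one writes down
   B' with (B, B') in Z_k: for k = 1 the map F only exchanges its coordinates on e_4
   and e_5, and for k = 2 the out-out minors of B' are the complementary in-in minors
   of B while the mixed ones are the entries of out_2 in_2 - lambda_2.  Comparing the
   Plucker coordinates of Phi B' with the matrix of the triality gives
   Phi B' = act(s_k) (Phi B).

   Every point of N lies on a polynomial curve in N that meets the open subset, so a
   regular function that vanishes there vanishes on N.  Hence the identity holds for
   all pi(B); as both sides are given by elements of C[N]^SL_2, it holds on all points
   of the quotient, and it passes to products since S_3 is generated by s_1 and s_2. *)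

Require Import Defs.
From HB Require Import structures.
From mathcomp Require Import all_boot all_order all_algebra all_fingroup.
From mathcomp Require Import boolp reals complex mpoly ring.

Set Implicit Arguments.
Unset Strict Implicit.
Unset Printing Implicit Defensive.

Import GRing.Theory Num.Theory.
Local Open Scope ring_scope.

(** For k = 2 the obstacle is the moment equation: the Plucker identities hold only modulo it. Where
    the last two columns of in_2 form an invertible matrix, it can be solved for the lower half of
    out_2; the other entries and lambda_2 are then independent variables, and every identity becomes
    one of rational functions. There B' is determined up to SL_2, and taking the invertible block
    itself as the upper half of out_2' fixes a representative. For k = 1 the pair (alpha1', beta1')
    is unique. The sign in [volume_normalized] matches these solutions: the determinant in the
    volume condition is -1 for k = 1 and 1 for k = 2, against the signs 1 and -1 in
    [volume_condition]. The triality is given on a frame that mixes H 1, ..., H 4, while Phi B has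
    Plucker coordinates on all e_i /\ e_j. Passing between the two costs a 4 x 4 system of
    determinant -6, hence the denominators 2 and 3; in the result s_2 acts on the H i by half a
    symmetric Hadamard matrix. *)

(** * Index cases, and independence of the frame for an abstract family e_i /\ e_j *)

Lemma ord3P (i : 'I_3) : [\/ i = 0, i = 1 | i = 2].
Proof.
by case: i => [[|[|[|//]]] hi]; [apply: Or31|apply: Or32|apply: Or33]; apply: val_inj.
Qed.

Lemma ord22_cases (P : nat -> nat -> Prop) : P 0%N 0%N -> P 0%N 1%N -> P 1%N 0%N -> P 1%N 1%N ->
  forall i j, (i < 2)%N -> (j < 2)%N -> P i j.
Proof. by move=> h0 h1 h2 h3 [|[|//]] [|[|//]]. Qed.

Lemma lt_pair8_ind (P : nat -> nat -> Prop) :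
  (P 1 2 -> P 1 3 -> P 2 3 -> P 1 4 -> P 2 4 -> P 3 4 -> P 1 5 -> P 2 5 -> P 3 5 -> P 4 5 ->
   P 1 6 -> P 2 6 -> P 3 6 -> P 4 6 -> P 5 6 -> P 1 7 -> P 2 7 -> P 3 7 -> P 4 7 -> P 5 7 ->
   P 6 7 -> P 1 8 -> P 2 8 -> P 3 8 -> P 4 8 -> P 5 8 -> P 6 8 -> P 7 8 ->
  forall i j, 0 < i -> i < j -> j <= 8 -> P i j)%N.
Proof.
do 28!move=> ?.
by move=> [|[|[|[|[|[|[|[|i]]]]]]]] [|[|[|[|[|[|[|[|[|j]]]]]]]]].
Qed.

Lemma subrBA (V : zmodType) (x y z : V) : x - (y - z) = x - y + z.
Proof. by rewrite opprD opprK addrA. Qed.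

Lemma subrBDl (V : zmodType) (x y : V) : x - y - (x + y) = - y *+ 2.
Proof. by rewrite opprD addrA [x - y]addrC addrK mulr2n. Qed.

(* [so8_frame 1] is [frame_of ew].  The family e is abstract because unification
   against [ew i j] otherwise unfolds it to a difference of matrices. *)
Definition frame_of (V : zmodType) (e : nat -> nat -> V) : seq V :=
  [:: e 2%N 6%N; e 1%N 3%N; e 1%N 2%N; e 3%N 7%N; e 6%N 8%N; e 7%N 8%N;
      e 2%N 7%N - e 3%N 6%N; e 1%N 8%N + e 3%N 6%N;
      e 1%N 8%N - e 2%N 7%N - e 3%N 6%N + e 4%N 5%N; - e 4%N 5%N *+ 2;
      - e 1%N 6%N; e 1%N 7%N; e 6%N 7%N; e 2%N 5%N; e 3%N 5%N; e 5%N 8%N;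
      e 2%N 4%N; e 3%N 4%N; e 4%N 8%N;
      e 2%N 3%N; e 2%N 8%N; - e 3%N 8%N; e 1%N 4%N; e 4%N 6%N; e 4%N 7%N;
      e 1%N 5%N; e 5%N 6%N; e 5%N 7%N].

Lemma eq_frame_of (V : zmodType) (e e' : nat -> nat -> V) :
  (forall i j, 0 < i <= 8 -> 0 < j <= 8 -> e i j = e' i j)%N -> frame_of e = frame_of e'.
Proof. by move=> ee; rewrite /frame_of !ee. Qed.

Lemma map_frame_of (V W : zmodType) (f : {additive W -> V}) e :
  map f (frame_of e) = frame_of (fun i j => f (e i j)).
Proof. by rewrite /frame_of /= !(raddfMn, raddfB, raddfD, raddfN). Qed.

Lemma sum28 (F : pzRingType) (K : nat -> F) (s : seq F) :
  \sum_(n < 28) K (nat_of_ord n) * s`_n = foldr (fun n x => K n * s`_n + x) 0 (iota 0 28).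
Proof. by rewrite -(big_mkord xpredT (fun n => K n * s`_n)) unlock. Qed.

(** Outside positions 6 to 9 each member is, up to sign, a single e_i /\ e_j that occurs in no other
    member, so the equation at (i, j) isolates its coefficient. Positions 6 to 9 involve only the
    four e_i /\ e_(9-i), with a matrix of determinant -6. *)
Lemma frame_of_coef0 (F : numFieldType) (K : nat -> F) :
  (forall i j, (0 < i <= 8)%N -> (0 < j <= 8)%N ->
  \sum_(n < 28) K (nat_of_ord n) *
    (frame_of (fun k l => ((i == k) && (j == l))%:R - ((i == l) && (j == k))%:R))`_n = 0) ->
  forall n, (n < 28)%N -> K n = 0.
Proof.
move=> h.
have {}h i j (hi : (0 < i <= 8)%N) (hj : (0 < j <= 8)%N) := etrans (esym (sum28 _ _)) (h i j hi hj).
pose simp := (mulr0, mulr1, mulrN, addr0, add0r, subr0, sub0r, mulr1n, oppr0, mul0rn).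
move: (h 1 8 isT isT)%N; rewrite /= ?simp => e18.
move: (h 2 7 isT isT)%N; rewrite /= ?simp => e27.
move: (h 3 6 isT isT)%N; rewrite /= ?simp => e36.
move: (h 4 5 isT isT)%N; rewrite /= ?simp => e45.
have K8 : K 8 = 0.
  (* The equation at (1, 8) minus those at (2, 7) and (3, 6). *)
  have : K 8 *+ 3 = (K 7 + K 8) - (K 6 - K 8) - (- K 6 + (K 7 - K 8)) by ring.
  by rewrite e18 e27 e36 !subr0 => /eqP; rewrite mulrn_eq0 => /eqP.
rewrite K8 ?simp in e18 e27 e45.
have K9 : K 9 = 0.
  by apply/eqP; move/eqP: e45; rewrite mulrnAr mulrN1 mulrn_eq0 oppr_eq0.
case=> [_|]; first by move: (h 2 6 isT isT)%N; rewrite /= ?simp.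
case=> [_|]; first by move: (h 1 3 isT isT)%N; rewrite /= ?simp.
case=> [_|]; first by move: (h 1 2 isT isT)%N; rewrite /= ?simp.
case=> [_|]; first by move: (h 3 7 isT isT)%N; rewrite /= ?simp.
case=> [_|]; first by move: (h 6 8 isT isT)%N; rewrite /= ?simp.
case=> [_|]; first by move: (h 7 8 isT isT)%N; rewrite /= ?simp.
do 4![case=> [//|]].
case=> [_|]; first by apply: oppr_inj; move: (h 1 6 isT isT)%N; rewrite /= ?simp.
case=> [_|]; first by move: (h 1 7 isT isT)%N; rewrite /= ?simp.
case=> [_|]; first by move: (h 6 7 isT isT)%N; rewrite /= ?simp.
case=> [_|]; first by move: (h 2 5 isT isT)%N; rewrite /= ?simp.
case=> [_|]; first by move: (h 3 5 isT isT)%N; rewrite /= ?simp.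
case=> [_|]; first by move: (h 5 8 isT isT)%N; rewrite /= ?simp.
case=> [_|]; first by move: (h 2 4 isT isT)%N; rewrite /= ?simp.
case=> [_|]; first by move: (h 3 4 isT isT)%N; rewrite /= ?simp.
case=> [_|]; first by move: (h 4 8 isT isT)%N; rewrite /= ?simp.
case=> [_|]; first by move: (h 2 3 isT isT)%N; rewrite /= ?simp.
case=> [_|]; first by move: (h 2 8 isT isT)%N; rewrite /= ?simp.
case=> [_|]; first by apply: oppr_inj; move: (h 3 8 isT isT)%N; rewrite /= ?simp.
case=> [_|]; first by move: (h 1 4 isT isT)%N; rewrite /= ?simp.
case=> [_|]; first by move: (h 4 6 isT isT)%N; rewrite /= ?simp.
case=> [_|]; first by move: (h 4 7 isT isT)%N; rewrite /= ?simp.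
case=> [_|]; first by move: (h 1 5 isT isT)%N; rewrite /= ?simp.
case=> [_|]; first by move: (h 5 6 isT isT)%N; rewrite /= ?simp.
case=> [_|]; first by move: (h 5 7 isT isT)%N; rewrite /= ?simp.
by [].
Qed.

(** * The frame as matrices, and the triality as a linear map on it *)

Section Frame.
Variable R : realType.
Notation C := (R[i]).
Notation ew := (ew R).
Notation H := (H R).

Lemma wedge_entry (u v : 'cV[C]_8) r c :
  wedge u v r c = v r 0 * u (rev_ord c) 0 - u r 0 * v (rev_ord c) 0.
Proof.
have h (w : 'cV[C]_8) : (w^T *m form8 R) 0 c = w (rev_ord c) 0.
  rewrite mxE (bigD1 (rev_ord c)) //= !mxE /= big1 => [|k kc].
    have -> : (8 - c.+1 + c)%N = 7%N by case: c => [[|[|[|[|[|[|[|[|]]]]]]]]].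
    by rewrite mulr1 addr0.
  rewrite !mxE; case: eqP => [e|_]; last by rewrite mulr0.
  case/eqP: kc; apply: val_inj => /=.
  by rewrite (subSS c 7); apply: canRL (addnK c) _.
by rewrite !mxE !big_ord1 !h.
Qed.

Lemma ew_entry i j (r c : 'I_8) : (0 < i <= 8)%N -> (0 < j <= 8)%N ->
  ew i j r c = ((r.+1 == j) && (c + i == 8))%N%:R - ((r.+1 == i) && (c + j == 8))%N%:R.
Proof.
move=> hi hj; rewrite wedge_entry !mxE !andbT -!natrM !mulnb.
have h k (l : 'I_8) : (0 < k <= 8)%N -> (l == inord k.-1) = (l.+1 == k)%N.
  by case: k => // k hk; rewrite -val_eqE /= inordK.
rewrite !h //=.
have h' k : (0 < k <= 8)%N -> ((8 - c.+1).+1 == k) = (c + k == 8)%N.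
  move=> hk; rewrite subnSK // -(eqn_add2l c) subnKC 1?eq_sym //.
  by apply: ltnW.
by rewrite !h'.
Qed.

Definition coroot (i : 'I_3) : 'M[C]_8 :=
  tnth [tuple H 1 - H 2; H 3 - H 4; H 3 + H 4] i.

Local Opaque wedge.

Lemma phi2E (c : 'rV[C]_3) : phi2 c = \sum_i c 0 i *: coroot i.
Proof.
rewrite !big_ord_recl big_ord0 addr0 addrA.
have -> : lift ord0 ord0 = 1 :> 'I_3 by apply: val_inj.
by have -> : lift ord0 (lift ord0 ord0) = 2 :> 'I_3 by apply: val_inj.
Qed.

Lemma phi2_delta i : phi2 (delta_mx 0 i : 'rV[C]_3) = coroot i.
Proof.
rewrite phi2E (bigD1 i) //= mxE !eqxx scale1r big1 ?addr0 // => j ji.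
by rewrite mxE (negPf ji) scale0r.
Qed.

Lemma phi2B (c d : 'rV[C]_3) : phi2 (c - d) = phi2 c - phi2 d.
Proof.
by rewrite !phi2E -sumrB; apply: eq_bigr => i _; rewrite !mxE scalerBl.
Qed.

Lemma h_act_deltaB (s : 'S_3) i j :
  h_act s (delta_mx 0 i - delta_mx 0 j : 'rV[C]_3) = delta_mx 0 (s i) - delta_mx 0 (s j).
Proof.
apply/rowP => k; rewrite !mxE !eqxx /=.
by rewrite -2!(inj_eq (@perm_inj _ s) (s^-1%g k)) permKV.
Qed.

Lemma phi2_h_actB (s : 'S_3) i j :
  phi2 (h_act s (delta_mx 0 i - delta_mx 0 j : 'rV[C]_3)) = coroot (s i) - coroot (s j).
Proof. by rewrite h_act_deltaB phi2B !phi2_delta. Qed.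

Lemma frameE (s : 'S_3) : so8_frame R s =
  L_basis R ++ [:: coroot (s 0) - coroot (s 1); coroot (s 1) - coroot (s 2)]
    ++ (V_basis R (s 0) ++ V_basis R (s 1) ++ V_basis R (s 2))
    ++ (Vdual_basis R (s 0) ++ Vdual_basis R (s 1) ++ Vdual_basis R (s 2)) :> seq _.
Proof. by rewrite -!phi2_h_actB. Qed.

Lemma frame1E : so8_frame R 1%g = frame_of ew :> seq _.
Proof.
rewrite frameE !perm1.
have e1 : coroot 0 - coroot 1 = ew 1 8 - ew 2 7 - ew 3 6 + ew 4 5.
  exact: subrBA (H 1 - H 2) (H 3) (H 4).
have e2 : coroot 1 - coroot 2 = - ew 4 5 *+ 2.
  exact: subrBDl (H 3) (H 4).
apply: etrans (congr2 (fun a b => L_basis R ++ [:: a; b]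
  ++ (V_basis R 0 ++ V_basis R 1 ++ V_basis R 2)
  ++ (Vdual_basis R 0 ++ Vdual_basis R 1 ++ Vdual_basis R 2)) e1 e2) _.
by [].
Qed.

(** The coefficient of e_i /\ e_j: this wedge sends e_(9-i) to e_j, which is row j - 1 and column 8
    - i when counting from 0. *)
Definition ecoef (i j : nat) (x : 'M[C]_8) : C := x (inord j.-1) (inord (8 - i)).

Lemma ecoef_ew i j k l :
  (0 < i <= 8)%N -> (0 < j <= 8)%N -> (0 < k <= 8)%N -> (0 < l <= 8)%N ->
  ecoef i j (ew k l) = ((i == k) && (j == l))%:R - ((i == l) && (j == k))%:R.
Proof.
move=> /andP[i0 i8] /andP[j0 j8] hk hl.
have hi : (8 - i < 8)%N by rewrite ltn_subrL i0.
have hj : (j.-1 < 8)%N by rewrite prednK.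
rewrite /ecoef ew_entry // (inordK hi) (inordK hj) prednK //.
have e m : (8 - i + m == 8)%N = (i == m).
  by have := eqn_add2l (8 - i) m i; rewrite subnK // => ->; rewrite eq_sym.
by rewrite !e ![(i == _) && _]andbC.
Qed.

Lemma ecoef_linear i j : linear (ecoef i j).
Proof. by move=> a x y; rewrite /ecoef !mxE. Qed.

HB.instance Definition _ i j :=
  GRing.isLinear.Build C 'M[C]_8 C^o *:%R (ecoef i j) (ecoef_linear i j).

Lemma frame1_free : free (so8_frame R 1%g).
Proof.
apply/freeP => k; pose K n := k (inord n).
have kK i : k i = K i by rewrite /K inord_val.
rewrite (eq_bigr (fun i : 'I_28 => K i *: (so8_frame R 1%g)`_i)) => [|i _]; last first.
  by rewrite kK.
rewrite frame1E => e0 i; rewrite kK; move: (ltn_ord i).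
apply: frame_of_coef0 => a b ha hb.
have e := congr1 (ecoef a b) e0; rewrite linear_sum linear0 in e.
rewrite -[RHS]e -(@eq_frame_of _ (fun k l => ecoef a b (ew k l))); last first.
  by move=> c d hc hd; rewrite ecoef_ew.
rewrite -map_frame_of; apply: eq_bigr => n _.
by rewrite linearZ (nth_map 0).
Qed.

Lemma triality_linear s : linear (@triality_act R s).
Proof.
move=> a x y; rewrite /triality_act scaler_sumr -big_split /=.
by apply: eq_bigr => k _; rewrite linearP scalerDl scalerA.
Qed.

HB.instance Definition _ s :=
  GRing.isLinear.Build C 'M[C]_8 'M[C]_8 *:%R (@triality_act R s) (triality_linear s).

Lemma triality_frame s k : (k < 28)%N ->
  triality_act s (so8_frame R 1%g)`_k = (so8_frame R s)`_k.
Proof.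
move=> hk; suff h (i : 'I_28) :
    triality_act s (so8_frame R 1%g)`_i = (so8_frame R s)`_i by exact: (h (Ordinal hk)).
rewrite /triality_act (bigD1 i) //= big1 => [|j ji].
  by rewrite coord_free ?frame1_free // eqxx scale1r addr0.
by rewrite coord_free ?frame1_free // eq_sym (negPf ji) scale0r.
Qed.

End Frame.

(** * The triality on the blocks L, h, V_i and their duals *)

Section FrameNth.
Variables (T : Type) (x0 x y : T) (L : 8.-tuple T).
Variables V0 V1 V2 W0 W1 W2 : 3.-tuple T.
Let s := L ++ [:: x; y] ++ (V0 ++ V1 ++ V2) ++ (W0 ++ W1 ++ W2).

Lemma nth_frameL k : (k < 8)%N -> nth x0 s k = nth x0 L k.
Proof. by move=> hk; rewrite nth_cat size_tuple hk. Qed.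

Lemma nth_frameH : (nth x0 s 8 = x) * (nth x0 s 9 = y).
Proof. by rewrite !nth_cat size_tuple. Qed.

Lemma nth_frameV k : (k < 3)%N ->
  [/\ nth x0 s (k + 10) = nth x0 V0 k, nth x0 s (k + 13) = nth x0 V1 k &
      nth x0 s (k + 16) = nth x0 V2 k] /\
  [/\ nth x0 s (k + 19) = nth x0 W0 k, nth x0 s (k + 22) = nth x0 W1 k &
      nth x0 s (k + 25) = nth x0 W2 k].
Proof.
rewrite /s; move: L V0 V1 V2 W0 W1 W2.
do 7!case=> [[|? [|? [|? [|? [|? [|? [|? [|? [|]]]]]]]]] //= ?].
by case: k => [|[|[|]]].
Qed.

End FrameNth.

Section TrialityOnBasis.
Variable R : realType.
Notation C := (R[i]).
Notation ew := (ew R).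
Notation H := (H R).
Notation coroot := (coroot R).

Lemma trialityD s (x y : 'M[C]_8) :
  triality_act s (x + y) = triality_act s x + triality_act s y.
Proof. exact: raddfD. Qed.

Lemma trialityB s (x y : 'M[C]_8) :
  triality_act s (x - y) = triality_act s x - triality_act s y.
Proof. exact: raddfB. Qed.

Lemma trialityN s (x : 'M[C]_8) : triality_act s (- x) = - triality_act s x.
Proof. exact: raddfN. Qed.

Lemma trialityZ s a (x : 'M[C]_8) : triality_act s (a *: x) = a *: triality_act s x.
Proof. exact: linearZ. Qed.

Lemma frame_nth_V (u : 'S_3) k : (k < 3)%N ->
  [/\ (so8_frame R u)`_(k + 10)%N = (V_basis R (u 0))`_k,
      (so8_frame R u)`_(k + 13)%N = (V_basis R (u 1))`_k &
      (so8_frame R u)`_(k + 16)%N = (V_basis R (u 2))`_k] /\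
  [/\ (so8_frame R u)`_(k + 19)%N = (Vdual_basis R (u 0))`_k,
      (so8_frame R u)`_(k + 22)%N = (Vdual_basis R (u 1))`_k &
      (so8_frame R u)`_(k + 25)%N = (Vdual_basis R (u 2))`_k].
Proof. by rewrite frameE; exact: nth_frameV. Qed.

Lemma frame_nth_L (u : 'S_3) k : (k < 8)%N -> (so8_frame R u)`_k = (L_basis R)`_k.
Proof. by rewrite frameE; exact: nth_frameL. Qed.

Lemma frame_nth_coroot (u : 'S_3) : ((so8_frame R u)`_8 = coroot (u 0) - coroot (u 1)) *
           ((so8_frame R u)`_9 = coroot (u 1) - coroot (u 2)).
Proof. by rewrite frameE; exact: nth_frameH. Qed.

Lemma triality_L s k : (k < 8)%N -> triality_act s (L_basis R)`_k = (L_basis R)`_k.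
Proof.
by move=> hk; rewrite -{1}(frame_nth_L 1%g hk) triality_frame ?frame_nth_L // (leq_trans hk).
Qed.

(** The frame contains only the differences 0 - 1 and 1 - 2 of coroots; the others are telescoping
    combinations of these. *)
Lemma triality_coroot s i j : triality_act s (coroot i - coroot j) = coroot (s i) - coroot (s j).
Proof.
have h := frame_nth_coroot.
have h01 : triality_act s (coroot 0 - coroot 1) = coroot (s 0) - coroot (s 1).
  by rewrite -h -triality_frame // h !perm1.
have h12 : triality_act s (coroot 1 - coroot 2) = coroot (s 1) - coroot (s 2).
  by rewrite -h -triality_frame // h !perm1.
have e (a b c : 'M[C]_8) : a - c = (a - b) + (b - c) by rewrite addrA subrK.
suff {i j} h' k : triality_act s (coroot 0 - coroot k) = coroot (s 0) - coroot (s k).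
  have d (a b c : 'M[C]_8) : a - c = (b - c) - (b - a) by rewrite opprB [RHS]addrC -e.
  by rewrite (d (coroot i) (coroot 0) (coroot j)) trialityB !h' -d.
have [->|->|->] := ord3P k; last first.
- by rewrite (e _ (coroot 1)) trialityD h01 h12 -e.
- exact: h01.
- by rewrite !subrr; exact: raddf0.
Qed.

Local Opaque V_basis Vdual_basis.

Lemma triality_V s i k : (k < 3)%N ->
  (triality_act s (V_basis R i)`_k = (V_basis R (s i))`_k) *
  (triality_act s (Vdual_basis R i)`_k = (Vdual_basis R (s i))`_k).
Proof.
move=> hk.
have hl n : (n <= 25)%N -> (k + n < 28)%N by move=> hn; exact: (leq_add hk hn).
have [[a0 a1 a2] [b0 b1 b2]] := frame_nth_V 1%g hk.
rewrite !perm1 in a0 a1 a2 b0 b1 b2.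
have [[c0 c1 c2] [d0 d1 d2]] := frame_nth_V s hk.
have t n (v w : 'M[C]_8) : (n <= 25)%N -> (so8_frame R 1%g)`_(k + n)%N = v ->
    (so8_frame R s)`_(k + n)%N = w -> triality_act s v = w.
  by move=> hn <- <-; exact: triality_frame (hl _ hn).
have [->|->|->] := ord3P i; split;
  [exact: t a0 c0|exact: t b0 d0|exact: t a1 c1|exact: t b1 d1|exact: t a2 c2|exact: t b2 d2].
Qed.

End TrialityOnBasis.

(** * The composition law of the triality *)

Section TrialityLaw.
Variable R : realType.
Notation C := (R[i]).
Notation ew := (ew R).
Notation coroot := (coroot R).
Local Opaque Defs.ew.

Lemma triality_frameM (s t : 'S_3) k : (k < 28)%N ->
  triality_act t (so8_frame R s)`_k = (so8_frame R (s * t)%g)`_k.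
Proof.
move=> hk; case: (ltnP k 8) => [k8|k8].
  by rewrite !frame_nth_L ?triality_L.
have hH := @frame_nth_coroot R.
have [->|k8'] := eqVneq k 8; first by rewrite !hH triality_coroot !permM.
have [->|k9'] := eqVneq k 9; first by rewrite !hH triality_coroot !permM.
have tV j v w i : (j < 3)%N -> v = (V_basis R (s i))`_j ->
    w = (V_basis R ((s * t)%g i))`_j -> triality_act t v = w.
  by move=> j3 -> ->; rewrite permM; case: (triality_V R t (s i) j3).
have tW j v w i : (j < 3)%N -> v = (Vdual_basis R (s i))`_j ->
    w = (Vdual_basis R ((s * t)%g i))`_j -> triality_act t v = w.
  by move=> j3 -> ->; rewrite permM; case: (triality_V R t (s i) j3).
(* After the ten members from L and h come six blocks of three: k is member j of block q. *)
have [q [j [j3 q6 ek]]] : exists q j, [/\ (j < 3)%N, (q < 6)%N & k = (j + (10 + 3 * q))%N].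
  exists ((k - 10) %/ 3)%N, ((k - 10) %% 3)%N; split; first by rewrite ltn_mod.
    by rewrite ltn_divLR // ltn_subLR //; case: k k8 k8' k9' {hk} => [|[|[|[|[|[|[|[|[|[|]]]]]]]]]].
  rewrite [(10 + _)%N]addnC addnA [(_ + 3 * _)%N]addnC [(3 * _)%N]mulnC -divn_eq subnK //.
  by case: k k8 k8' k9' {hk} => [|[|[|[|[|[|[|[|[|[|]]]]]]]]]].
have [[s0 s1 s2] [s3 s4 s5]] := frame_nth_V R s j3.
have [[t0 t1 t2] [t3 t4 t5]] := frame_nth_V R (s * t)%g j3.
rewrite ek.
case: q q6 {ek} => [|[|[|[|[|[|//]]]]]] _.
- exact: tV j3 s0 t0.
- exact: tV j3 s1 t1.
- exact: tV j3 s2 t2.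
- exact: tW j3 s3 t3.
- exact: tW j3 s4 t4.
- exact: tW j3 s5 t5.
Qed.

Lemma trialityM (s t : 'S_3) x : x \in <<so8_frame R 1%g>>%VS ->
  triality_act (s * t)%g x = triality_act t (triality_act s x).
Proof.
suff h (a : 'I_28 -> C) : triality_act (s * t)%g (\sum_(k < 28) a k *: (so8_frame R 1%g)`_k) =
    triality_act t (triality_act s (\sum_(k < 28) a k *: (so8_frame R 1%g)`_k)).
  by move=> /coord_span ->; exact: h.
have hT u (X : 28.-tuple 'M[C]_8) :
    triality_act u (\sum_(k < 28) a k *: X`_k) = \sum_(k < 28) a k *: triality_act u X`_k.
  by rewrite [LHS]raddf_sum; apply: eq_bigr => k _; exact: trialityZ.
have h' u : triality_act u (\sum_(k < 28) a k *: (so8_frame R 1%g)`_k) =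
    \sum_(k < 28) a k *: (so8_frame R u)`_k.
  by rewrite hT; apply: eq_bigr => k _; rewrite triality_frame.
rewrite [LHS]h' [X in triality_act t X]h' hT; apply: eq_bigr => k _.
by rewrite triality_frameM.
Qed.

(** The values of [triality_act] lie in the span of the frame, so [triality_act 1] can be the
    identity only there. *)
Lemma triality1 x : x \in <<so8_frame R 1%g>>%VS -> triality_act 1%g x = x.
Proof. by move=> /coord_span {2}->. Qed.

End TrialityLaw.

(** * The simple reflections in Plucker coordinates *)

Section PluckerSums.
Variables (F : numFieldType).
Implicit Types p e : nat -> nat -> F.

Definition sum_lt8 (p e : nat -> nat -> F) :=
  \sum_(2 <= j < 9) \sum_(1 <= i < j) p i j * e i j.

(* The simple reflections act on e_i /\ e_j (i < j) by symmetric matrices, so the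
   same formulas describe their action on the coordinates p_ij. *)
Definition coef_s1 p i j : F :=
  match i, j with
  | 2, 4 => p 2 5 | 2, 5 => p 2 4 | 3, 4 => p 3 5 | 3, 5 => p 3 4
  | 4, 8 => p 5 8 | 5, 8 => p 4 8 | 1, 4 => p 1 5 | 1, 5 => p 1 4
  | 4, 6 => p 5 6 | 5, 6 => p 4 6 | 4, 7 => p 5 7 | 5, 7 => p 4 7
  | 4, 5 => - p 4 5
  | _, _ => p i j
  end%N.

Definition coef_s2 p i j : F :=
  match i, j with
  | 1, 6 => - p 2 4 | 2, 4 => - p 1 6 | 1, 7 => p 3 4 | 3, 4 => p 1 7
  | 6, 7 => p 4 8 | 4, 8 => p 6 7 | 2, 3 => p 1 5 | 1, 5 => p 2 3
  | 2, 8 => p 5 6 | 5, 6 => p 2 8 | 3, 8 => - p 5 7 | 5, 7 => - p 3 8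
  | 1, 8 => (p 1 8 + p 2 7 + p 3 6 + p 4 5) / 2
  | 2, 7 => (p 1 8 + p 2 7 - p 3 6 - p 4 5) / 2
  | 3, 6 => (p 1 8 - p 2 7 + p 3 6 - p 4 5) / 2
  | 4, 5 => (p 1 8 - p 2 7 - p 3 6 + p 4 5) / 2
  | _, _ => p i j
  end%N.

Lemma sum_lt8_s1 p e : sum_lt8 p (coef_s1 e) = sum_lt8 (coef_s1 p) e.
Proof. rewrite /sum_lt8 unlock /=; ring. Qed.

Lemma sum_lt8_s2 p e : sum_lt8 p (coef_s2 e) = sum_lt8 (coef_s2 p) e.
Proof. by rewrite /sum_lt8 unlock /=; field. Qed.

Lemma eq_sum_lt8 p p' e e' :
  (forall i j, (0 < i)%N -> (i < j)%N -> (j <= 8)%N -> p i j = p' i j /\ e i j = e' i j) ->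
  sum_lt8 p e = sum_lt8 p' e'.
Proof.
move=> h; apply: eq_big_nat => j /andP[j1 j8]; apply: eq_big_nat => i /andP[i0 ij].
by case: (h i j i0 ij j8) => -> ->.
Qed.

(** The Binet-Cauchy identity. With d and d' the entries of the e_k in row r and in row [rev_ord c],
    the second factor is the (r, c) entry of e_i /\ e_j. *)
Lemma sum_lt8_plucker (u w d d' : nat -> F) :
  sum_lt8 (fun i j => u i * w j - u j * w i) (fun i j => d j * d' i - d i * d' j) =
  (\sum_(1 <= k < 9) w k * d k) * (\sum_(1 <= k < 9) u k * d' k) -
  (\sum_(1 <= k < 9) u k * d k) * (\sum_(1 <= k < 9) w k * d' k).
Proof. rewrite /sum_lt8 unlock /=; ring. Qed.

End PluckerSums.

Section TrialityOnWedges.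
Variable R : realType.
Notation C := (R[i]).
Notation ew := (ew R).
Notation e8 := (e8 R).
Notation coroot := (coroot R).

Definition lin8 (u : nat -> C) : 'cV[C]_8 := \sum_(1 <= k < 9) u k *: e8 k.

Lemma ewE i j r c : ew i j r c = e8 j r 0 * e8 i (rev_ord c) 0 - e8 i r 0 * e8 j (rev_ord c) 0.
Proof. exact: wedge_entry. Qed.

Lemma lin8E (x : nat -> C) k : lin8 x k 0 = \sum_(1 <= l < 9) x l * e8 l k 0.
Proof. by rewrite summxE; apply: eq_bigr => l _; rewrite !mxE. Qed.

Local Opaque lin8.

Definition plucker (u w : nat -> C) i j := u i * w j - u j * w i.

Lemma wedge_lin8 u w r c :
  wedge (lin8 u) (lin8 w) r c = sum_lt8 (plucker u w) (fun i j => ew i j r c).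
Proof.
rewrite [LHS]wedge_entry !lin8E.
rewrite -sum_lt8_plucker; apply: eq_sum_lt8 => i j _ _ _.
by rewrite ewE.
Qed.

Lemma triality_sum s (I : Type) (l : seq I) P (f : I -> 'M[C]_8) :
  triality_act s (\sum_(i <- l | P i) f i) = \sum_(i <- l | P i) triality_act s (f i).
Proof. exact: raddf_sum. Qed.

(** The first hypothesis makes tau self-adjoint for the pairing [sum_lt8], so the action on the
    basis wedges can be moved to the Plucker coordinates. *)
Lemma triality_wedge s (tau : (nat -> nat -> C) -> nat -> nat -> C) u w :
  (forall p e, sum_lt8 p (tau e) = sum_lt8 (tau p) e) ->
  (forall i j r c, (0 < i)%N -> (i < j)%N -> (j <= 8)%N ->
     triality_act s (ew i j) r c = tau (fun a b => ew a b r c) i j) ->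
  forall r c, triality_act s (wedge (lin8 u) (lin8 w)) r c =
     sum_lt8 (tau (plucker u w)) (fun i j => ew i j r c).
Proof.
move=> ht hs r c; rewrite -ht.
have -> : wedge (lin8 u) (lin8 w) =
    \sum_(2 <= j < 9) \sum_(1 <= i < j) plucker u w i j *: ew i j.
  apply/matrixP => k l; rewrite wedge_lin8 summxE; apply: eq_bigr => j _.
  by rewrite summxE; apply: eq_bigr => i _; rewrite [RHS]mxE.
rewrite triality_sum summxE; apply: eq_big_nat => j /andP[_ j8].
rewrite triality_sum summxE; apply: eq_big_nat => i /andP[i0 ij].
by rewrite -hs // trialityZ mxE.
Qed.
Local Opaque Defs.ew.

(** For (a, b, c, d) = (H 1, H 2, H 3, H 4): the single H i are not in the frame, but H 4 and H 1
    are combinations of differences of coroots and of the members H 2 - H 3 and H 1 + H 3 of L,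
    whose images are known. *)
Lemma ew_coroot (a b c d : 'M[C]_8) :
  (d = - 2^-1 *: ((c - d) - (c + d))) *
  (a = 3^-1 *: ((a - b) - (c - d) + 2^-1 *: ((c - d) - (c + d)) + (b - c) + 2 *: (a + c))).
Proof. by split; apply/matrixP => r k; rewrite !mxE; field. Qed.

Lemma triality_ew45 s : triality_act s (ew 4 5) = - 2^-1 *: (coroot (s 1) - coroot (s 2)).
Proof.
rewrite -triality_coroot -trialityZ; congr (triality_act s _).
exact: (ew_coroot (H R 1) (H R 2) (H R 3) (H R 4)).1.
Qed.

Lemma triality_ew18 s : triality_act s (ew 1 8) = 3^-1 *: (coroot (s 0) - coroot (s 1)
   + 2^-1 *: (coroot (s 1) - coroot (s 2)) + (ew 2 7 - ew 3 6) + 2 *: (ew 1 8 + ew 3 6)).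
Proof.
rewrite -!triality_coroot.
have h6 : triality_act s (ew 2 7 - ew 3 6) = ew 2 7 - ew 3 6.
  exact: (triality_L R s (isT : 6 < 8)%N).
have h7 : triality_act s (ew 1 8 + ew 3 6) = ew 1 8 + ew 3 6.
  exact: (triality_L R s (isT : 7 < 8)%N).
have e : ew 1 8 = 3^-1 *: (coroot 0 - coroot 1 + 2^-1 *: (coroot 1 - coroot 2) + (ew 2 7 - ew 3 6)
    + 2 *: (ew 1 8 + ew 3 6)).
  exact: (ew_coroot (H R 1) (H R 2) (H R 3) (H R 4)).2.
have lin (x y z w : 'M[C]_8) : triality_act s (3^-1 *: (x + 2^-1 *: y + z + 2 *: w)) =
    3^-1 *: (triality_act s x + 2^-1 *: triality_act s y + triality_act s z
      + 2 *: triality_act s w).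
  by rewrite trialityZ !trialityD !trialityZ.
apply: etrans (congr1 (triality_act s) e) _.
by rewrite lin h6 h7.
Qed.

Lemma triality_ew36 s : triality_act s (ew 3 6) = ew 1 8 + ew 3 6 - triality_act s (ew 1 8).
Proof.
have h7 : triality_act s (ew 1 8 + ew 3 6) = ew 1 8 + ew 3 6.
  exact: (triality_L R s (isT : 7 < 8)%N).
by rewrite -h7 trialityD [RHS]addrC addKr.
Qed.

Lemma triality_ew27 s : triality_act s (ew 2 7) = ew 2 7 - ew 3 6 + triality_act s (ew 3 6).
Proof.
have h7 : triality_act s (ew 2 7 - ew 3 6) = ew 2 7 - ew 3 6.
  exact: (triality_L R s (isT : 6 < 8)%N).
by rewrite -h7 trialityB subrK.
Qed.

Lemma triality_V_to (s : 'S_3) (i i' : 'I_3) k : s i = i' -> (k < 3)%N ->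
  (triality_act s (V_basis R i)`_k = (V_basis R i')`_k) *
  (triality_act s (Vdual_basis R i)`_k = (Vdual_basis R i')`_k).
Proof. by move=> <-; exact: (triality_V R s i). Qed.

Let oppT s (x y : 'M[C]_8) : triality_act s (- x) = y -> triality_act s x = - y.
Proof. by move=> <-; rewrite trialityN opprK. Qed.

Lemma triality_s1_ew i j m l : (0 < i)%N -> (i < j)%N -> (j <= 8)%N ->
  triality_act s1 (ew i j) m l = coef_s1 (fun a b => ew a b m l) i j.
Proof.
have e0 : s1 0 = 0 by rewrite tpermD.
have e1 : s1 1 = 2 by rewrite tpermL.
have e2 : s1 2 = 1 by rewrite tpermR.
pose L k (h : (k < 8)%N) := triality_L R s1 h.
pose V0 k (h : (k < 3)%N) := triality_V_to e0 h.
pose V1 k (h : (k < 3)%N) := triality_V_to e1 h.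
pose V2 k (h : (k < 3)%N) := triality_V_to e2 h.
have ent (x y : 'M[C]_8) : x = y -> x m l = y m l by move=> ->.
have t45 : triality_act s1 (ew 4 5) = - ew 4 5.
  rewrite triality_ew45 e1 e2.
  have h (c d : 'M[C]_8) : - 2^-1 *: ((c + d) - (c - d)) = - d.
    by apply/matrixP => ? ?; rewrite !mxE; field.
  exact: h (H R 3) (H R 4).
have t18 : triality_act s1 (ew 1 8) = ew 1 8.
  rewrite triality_ew18 e0 e1 e2.
  have h (a b c d : 'M[C]_8) :
      3^-1 *: (a - b - (c + d) + 2^-1 *: ((c + d) - (c - d)) + (b - c) + 2 *: (a + c)) = a.
    by apply/matrixP => ? ?; rewrite !mxE; field.
  exact: h (H R 1) (H R 2) (H R 3) (H R 4).
have t36 : triality_act s1 (ew 3 6) = ew 3 6.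
  rewrite triality_ew36 t18; have h (a c : 'M[C]_8) : a + c - a = c by rewrite addrAC subrr add0r.
  exact: h.
have t27 : triality_act s1 (ew 2 7) = ew 2 7.
  by rewrite triality_ew27 t36; exact: subrK.
(* The 28 pairs come with j increasing, then i. All but the four with i + j = 9 belong to the frame
   up to sign; the sign occurs for (1, 6) and (3, 8). *)
case: j => [|[|[|[|[|[|[|[|[|j]]]]]]]]] //; case: i => [|[|[|[|[|[|[|[|i]]]]]]]] // _ _ _ /=.
- exact: (ent _ _ (L 2%N isT)).
- exact: (ent _ _ (L 1%N isT)).
- exact: (ent _ _ (V0 0%N isT).2).
- exact: (ent _ _ (V1 0%N isT).2).
- exact: (ent _ _ (V2 0%N isT).1).
- exact: (ent _ _ (V2 1%N isT).1).
- exact: (ent _ _ (V2 0%N isT).2).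
- exact: (ent _ _ (V1 0%N isT).1).
- exact: (ent _ _ (V1 1%N isT).1).
- by rewrite t45 !mxE.
- exact: (ent _ _ (oppr_inj (etrans (esym (trialityN _ _)) (V0 0%N isT).1))).
- exact: (ent _ _ (L 0%N isT)).
- by rewrite t36 !mxE.
- exact: (ent _ _ (V1 1%N isT).2).
- exact: (ent _ _ (V2 1%N isT).2).
- exact: (ent _ _ (V0 1%N isT).1).
- by rewrite t27 !mxE.
- exact: (ent _ _ (L 3%N isT)).
- exact: (ent _ _ (V1 2%N isT).2).
- exact: (ent _ _ (V2 2%N isT).2).
- exact: (ent _ _ (V0 2%N isT).1).
- by rewrite t18 !mxE.
- exact: (ent _ _ (V0 1%N isT).2).
- exact: (ent _ _ (oppr_inj (etrans (esym (trialityN _ _)) (V0 2%N isT).2))).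
- exact: (ent _ _ (V2 2%N isT).1).
- exact: (ent _ _ (V1 2%N isT).1).
- exact: (ent _ _ (L 4%N isT)).
- exact: (ent _ _ (L 5%N isT)).
Qed.

Lemma triality_s2_ew i j m l : (0 < i)%N -> (i < j)%N -> (j <= 8)%N ->
  triality_act s2 (ew i j) m l = coef_s2 (fun a b => ew a b m l) i j.
Proof.
have e0 : s2 0 = 2 by rewrite tpermL.
have e1 : s2 1 = 1 by rewrite tpermD.
have e2 : s2 2 = 0 by rewrite tpermR.
pose L k (h : (k < 8)%N) := triality_L R s2 h.
pose V0 k (h : (k < 3)%N) := triality_V_to e0 h.
pose V1 k (h : (k < 3)%N) := triality_V_to e1 h.
pose V2 k (h : (k < 3)%N) := triality_V_to e2 h.
have ent (x y : 'M[C]_8) : x = y -> x m l = y m l by move=> ->.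
have hN (x : 'M[C]_8) : (- x) m l = - x m l by rewrite mxE.
have t45 : triality_act s2 (ew 4 5) = 2^-1 *: (ew 1 8 - ew 2 7 - ew 3 6 + ew 4 5).
  rewrite triality_ew45 e1 e2.
  have h (a b c d : 'M[C]_8) : - 2^-1 *: ((c - d) - (a - b)) = 2^-1 *: (a - b - c + d).
    by apply/matrixP => ? ?; rewrite !mxE; field.
  exact: h (H R 1) (H R 2) (H R 3) (H R 4).
have t18 : triality_act s2 (ew 1 8) = 2^-1 *: (ew 1 8 + ew 2 7 + ew 3 6 + ew 4 5).
  rewrite triality_ew18 e0 e1 e2.
  have h (a b c d : 'M[C]_8) :
      3^-1 *: (c + d - (c - d) + 2^-1 *: ((c - d) - (a - b)) + (b - c) + 2 *: (a + c)) =
      2^-1 *: (a + b + c + d).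
    by apply/matrixP => ? ?; rewrite !mxE; field.
  exact: h (H R 1) (H R 2) (H R 3) (H R 4).
have t36 : triality_act s2 (ew 3 6) = 2^-1 *: (ew 1 8 - ew 2 7 + ew 3 6 - ew 4 5).
  rewrite triality_ew36 t18.
  have h (a b c d : 'M[C]_8) : a + c - 2^-1 *: (a + b + c + d) = 2^-1 *: (a - b + c - d).
    by apply/matrixP => ? ?; rewrite !mxE; field.
  exact: h (H R 1) (H R 2) (H R 3) (H R 4).
have t27 : triality_act s2 (ew 2 7) = 2^-1 *: (ew 1 8 + ew 2 7 - ew 3 6 - ew 4 5).
  rewrite triality_ew27 t36.
  have h (a b c d : 'M[C]_8) : b - c + 2^-1 *: (a - b + c - d) = 2^-1 *: (a + b - c - d).
    by apply/matrixP => ? ?; rewrite !mxE; field.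
  exact: h (H R 1) (H R 2) (H R 3) (H R 4).
have hx18 (a b c d : 'M[C]_8) : (2^-1 *: (a + b + c + d)) m l =
    (a m l + b m l + c m l + d m l) / 2.
  by rewrite !mxE mulrC.
have hx27 (a b c d : 'M[C]_8) : (2^-1 *: (a + b - c - d)) m l =
    (a m l + b m l - c m l - d m l) / 2.
  by rewrite !mxE mulrC.
have hx36 (a b c d : 'M[C]_8) : (2^-1 *: (a - b + c - d)) m l =
    (a m l - b m l + c m l - d m l) / 2.
  by rewrite !mxE mulrC.
have hx45 (a b c d : 'M[C]_8) : (2^-1 *: (a - b - c + d)) m l =
    (a m l - b m l - c m l + d m l) / 2.
  by rewrite !mxE mulrC.
case: j => [|[|[|[|[|[|[|[|[|j]]]]]]]]] //; case: i => [|[|[|[|[|[|[|[|i]]]]]]]] // _ _ _ /=.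
- exact: (ent _ _ (L 2%N isT)).
- exact: (ent _ _ (L 1%N isT)).
- exact: (ent _ _ (V0 0%N isT).2).
- exact: (ent _ _ (V1 0%N isT).2).
- exact: etrans (ent _ _ (V2 0%N isT).1) (hN _).
- exact: (ent _ _ (V2 1%N isT).1).
- exact: (ent _ _ (V2 0%N isT).2).
- exact: (ent _ _ (V1 0%N isT).1).
- exact: (ent _ _ (V1 1%N isT).1).
- apply: etrans (ent _ _ t45) _; exact: hx45.
- exact: etrans (ent _ _ (oppT (V0 0%N isT).1)) (hN _).
- exact: (ent _ _ (L 0%N isT)).
- apply: etrans (ent _ _ t36) _; exact: hx36.
- exact: (ent _ _ (V1 1%N isT).2).
- exact: (ent _ _ (V2 1%N isT).2).
- exact: (ent _ _ (V0 1%N isT).1).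
- apply: etrans (ent _ _ t27) _; exact: hx27.
- exact: (ent _ _ (L 3%N isT)).
- exact: (ent _ _ (V1 2%N isT).2).
- exact: etrans (ent _ _ (V2 2%N isT).2) (hN _).
- exact: (ent _ _ (V0 2%N isT).1).
- apply: etrans (ent _ _ t18) _; exact: hx18.
- exact: (ent _ _ (V0 1%N isT).2).
- exact: etrans (ent _ _ (oppT (V0 2%N isT).2)) (hN _).
- exact: (ent _ _ (V2 2%N isT).1).
- exact: (ent _ _ (V1 2%N isT).1).
- exact: (ent _ _ (L 4%N isT)).
- exact: (ent _ _ (L 5%N isT)).
Qed.

End TrialityOnWedges.

(** * Phi in terms of the entries of out_2 and in_2 *)

Section Entries.
Variable R : realType.
Notation C := (R[i]).

(* o lists the entries of out_2 = (alpha2; beta1) and n those of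
   in_2 = (beta2 | - alpha1), with 0-based indices. *)
Definition TV_of (o n : nat -> nat -> C) : TV R :=
  MkTV (\matrix_(i, j) - n i 3%N) (\matrix_(i, j) o i j) (\matrix_(i, j) o 3%N j)
       (\matrix_(i, j) n i j).

Lemma TV_ofP (B : TV R) : exists o n, B = TV_of o n.
Proof.
case: B => a1 a2 b1 b2.
exists (fun i j => if (i < 3)%N then a2 (inord i) (inord j) else b1 0 (inord j)).
exists (fun i j => if (j < 3)%N then b2 (inord i) (inord j) else - a1 (inord i) 0).
rewrite /TV_of; congr MkTV; apply/matrixP => i j; rewrite !mxE /= ?ltn_ord ?inord_val //.
- by rewrite opprK ord1.
- by rewrite ord1.
Qed.

Lemma in2_TV_of o n : in2 (TV_of o n) = \matrix_(i, j) n i j.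
Proof.
apply/matrixP => i j; rewrite [RHS]mxE.
rewrite -[LHS]/(row_mx (beta2 (TV_of o n)) (- alpha1 (TV_of o n)) i j) mxE.
case: splitP => k ek; rewrite !mxE ?opprK ek //.
by rewrite ord1.
Qed.

Lemma out2_TV_of o n : out2 (TV_of o n) = \matrix_(i, j) o i j.
Proof.
apply/matrixP => i j; rewrite [RHS]mxE.
rewrite -[LHS]/(col_mx (alpha2 (TV_of o n)) (beta1 (TV_of o n)) i j) mxE.
case: splitP => k ek; rewrite !mxE ek //.
by rewrite ord1.
Qed.

Definition in_out (o n : nat -> nat -> C) a b :=
  n a 0%N * o 0%N b + n a 1%N * o 1%N b + n a 2%N * o 2%N b + n a 3%N * o 3%N b.

Lemma moment_TV_of o n (a b : 'I_2) : moment (TV_of o n) a b = in_out o n a b.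
Proof.
rewrite !mxE !big_ord_recl !big_ord0 !mxE /= /in_out.
ring.
Qed.

Lemma inN_TV_of o n lam :
  (forall a b, (a < 2)%N -> (b < 2)%N -> in_out o n a b = lam *+ (a == b)) ->
  inN (TV_of o n).
Proof.
move=> h; exists lam; apply/matrixP => a b; rewrite moment_TV_of h ?ltn_ord //.
by rewrite mxE.
Qed.

Lemma inN_in_out o n : inN (TV_of o n) ->
  (forall a b, (a < 2)%N -> (b < 2)%N -> in_out o n a b = lambda2 (TV_of o n) *+ (a == b)).
Proof.
move=> [lam e] a b ha hb; rewrite /lambda2 e mxE mulr1n.
by have := moment_TV_of o n (Ordinal ha) (Ordinal hb); rewrite e mxE.
Qed.

(** The coordinates of F on the first basis vector of C^2; the leading 0 is padding, since [e8]
    counts from 1. Positions 2, 3, 4, 8 come from out_2 and positions 1, 5, 6, 7 from in_2, so the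
    Plucker coordinates are out-out, in-in and mixed minors. *)
Definition Fcoef1 (o n : nat -> nat -> C) (k : nat) : C :=
  nth 0 [:: 0; n 1%N 2%N; o 0%N 0%N; o 1%N 0%N; - o 3%N 0%N; n 1%N 3%N;
    - n 1%N 1%N; - n 1%N 0%N; - o 2%N 0%N] k.
Definition Fcoef2 (o n : nat -> nat -> C) (k : nat) : C :=
  nth 0 [:: 0; - n 0%N 2%N; o 0%N 1%N; o 1%N 1%N; - o 3%N 1%N; - n 0%N 3%N;
    n 0%N 1%N; n 0%N 0%N; - o 2%N 1%N] k.

Lemma eta_lin8 z a b w : Defs.eta z a b w = lin8 (fun k =>
  nth 0 [:: 0; - w 0 2; z 0 0; z 1 0; a; b; w 0 1; w 0 0; - z 2 0] k) :> 'cV[C]_8.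
Proof.
apply/matrixP => k j; rewrite ord1 lin8E /Defs.eta unlock /=.
move: (e8 R 1) (e8 R 2) (e8 R 3) (e8 R 4) (e8 R 5) (e8 R 6) (e8 R 7) (e8 R 8).
by move=> *; rewrite !mxE /=; ring.
Qed.

Lemma F_TV_of o n v : F (TV_of o n) v = lin8 (fun k =>
  let z i := o i 0%N * v 0 0 + o i 1%N * v 1 0 in
  let w j := n 0%N j * v 1 0 - n 1%N j * v 0 0 in
  nth 0 [:: 0; - w 2%N; z 0%N; z 1%N; - z 3%N; - w 3%N; w 1%N; w 0%N; - z 2%N] k).
Proof.
have e1 : lift ord0 ord0 = 1 :> 'I_2 by apply: val_inj.
have hz i : (alpha2 (TV_of o n) *m v) i 0 = o i 0%N * v 0 0 + o i 1%N * v 1 0.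
  by rewrite mxE !big_ord_recl big_ord0 !mxE addr0 e1.
have hb : - (beta1 (TV_of o n) *m v) 0 0 = - (o 3%N 0%N * v 0 0 + o 3%N 1%N * v 1 0).
  by rewrite mxE !big_ord_recl big_ord0 !mxE addr0 e1.
have hw j : (\row_j \det (row_mx (col j (beta2 (TV_of o n))) v) : 'rV_3) 0 j =
    n 0%N j * v 1 0 - n 1%N j * v 0 0.
  by rewrite mxE det_row_mx2 !mxE.
rewrite /F eta_lin8 hb !hz !hw det_row_mx2 !mxE.
rewrite !mulNr -opprD; congr lin8.
Qed.

Lemma eq_lin8 (u v : nat -> C) :
  (forall k, (0 < k < 9)%N -> u k = v k) -> lin8 u = lin8 v.
Proof. by move=> h; apply: eq_big_nat => k hk; rewrite h. Qed.

Lemma Phi_TV_of o n : Phi (TV_of o n) = wedge (lin8 (Fcoef1 o n)) (lin8 (Fcoef2 o n)).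
Proof.
have h1 : F (TV_of o n) (delta_mx 0 0) = lin8 (Fcoef1 o n).
  rewrite F_TV_of; apply: eq_lin8.
  by case=> [|[|[|[|[|[|[|[|[|k]]]]]]]]] // _;
    rewrite /Fcoef1 !mxE /= !(mulr1, mulr0, addr0, sub0r, oppr0, opprK).
have h2 : F (TV_of o n) (delta_mx 1 0) = lin8 (Fcoef2 o n).
  rewrite F_TV_of; apply: eq_lin8.
  by case=> [|[|[|[|[|[|[|[|[|k]]]]]]]]] // _;
    rewrite /Fcoef2 !mxE /= !(mulr1, mulr0, add0r, subr0, oppr0, opprK).
by rewrite /Phi h1 h2.
Qed.

Lemma Phi_triality s (tau : (nat -> nat -> C) -> nat -> nat -> C) o n o' n' :
  (forall p e, sum_lt8 p (tau e) = sum_lt8 (tau p) e) ->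
  (forall i j r c, (0 < i)%N -> (i < j)%N -> (j <= 8)%N ->
     triality_act s (ew R i j) r c = tau (fun a b => ew R a b r c) i j) ->
  (forall i j, (0 < i)%N -> (i < j)%N -> (j <= 8)%N ->
     plucker (Fcoef1 o' n') (Fcoef2 o' n') i j = tau (plucker (Fcoef1 o n) (Fcoef2 o n)) i j) ->
  Phi (TV_of o' n') = triality_act s (Phi (TV_of o n)).
Proof.
move=> ht hs h; apply/matrixP => r c; rewrite !Phi_TV_of.
rewrite (triality_wedge _ _ ht hs) wedge_lin8; apply: eq_sum_lt8 => i j i0 ij j8.
by rewrite h.
Qed.

(* h and W split the sequence; the last clause makes the volume condition a
   statement about W alone. *)
Lemma split_exact (F : comUnitRingType) k (f W : 'M[F]_(k + k, k)) (g h : 'M[F]_(k, k + k)) :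
  h *m f = 1%:M -> g *m f = 0 -> h *m W = 0 -> g *m W = 1%:M -> f *m h + W *m g = 1%:M ->
  [/\ forall u : 'cV_k, f *m u = 0 -> u = 0,
      forall v : 'cV_(k + k), g *m v = 0 <-> exists u : 'cV_k, v = f *m u,
      forall w : 'cV_k, exists v : 'cV_(k + k), g *m v = w
    & forall W', g *m W' = 1%:M -> \det (row_mx f W') = \det (row_mx f W)].
Proof.
move=> hf gf hW gW e; split.
- by move=> u fu; rewrite -[u]mul1mx -hf -mulmxA fu mulmx0.
- move=> v; split=> [gv|[u ->]]; last by rewrite mulmxA gf mul0mx.
  by exists (h *m v); rewrite -[LHS]mul1mx -e mulmxDl -!mulmxA gv mulmx0 addr0.
- by move=> w; exists (W *m w); rewrite mulmxA gW mul1mx.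
move=> W' gW'.
have eW' : W' = f *m (h *m W') + W.
  by rewrite -[LHS]mul1mx -e mulmxDl -!mulmxA gW' mulmx1.
have -> : row_mx f W' = row_mx f W *m block_mx 1%:M (h *m W') 0 1%:M.
  by rewrite mul_row_block !mulmx1 mulmx0 addr0 -eW'.
by rewrite det_mulmx det_ublock !det1 !mulr1.
Qed.

End Entries.

(** * The solution of Z_1 where beta1 is nonzero *)

Section FirstReflection.
Variable R : realType.
Notation C := (R[i]).
Implicit Types o n : nat -> nat -> C.

Lemma in1_TV_of o n : in1 (TV_of o n) = \matrix_(i, j) o 3%N j.
Proof.
apply/matrixP => i j; rewrite [RHS]mxE.
rewrite -[LHS]/(row_mx (beta1 (TV_of o n)) (- 0 : 'M_(1, 0)) i j) mxE.
by case: splitP => k ek; [rewrite !mxE ek | case: k ek].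
Qed.

Lemma out1_TV_of o n : out1 (TV_of o n) = \matrix_(i, j) - n i 3%N.
Proof.
apply/matrixP => i j; rewrite [RHS]mxE.
rewrite -[LHS]/(col_mx (alpha1 (TV_of o n)) (0 : 'M_(0, 1)) i j) mxE.
by case: splitP => k ek; [rewrite !mxE ek | case: k ek].
Qed.

(* alpha1' = (- beta1_2, beta1_1) and beta1' = (alpha1_2, - alpha1_1): this swaps
   the coordinates of F on e_4 and e_5. *)
Definition out_s1 o n i j : C :=
  if i == 3%N then (if j == 0%N then - n 1%N 3%N else n 0%N 3%N) else o i j.
Definition in_s1 o n i j : C :=
  if j == 3%N then (if i == 0%N then o 3%N 1%N else - o 3%N 0%N) else n i j.

Lemma plucker_s1 o n i j : (0 < i)%N -> (i < j)%N -> (j <= 8)%N ->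
  plucker (Fcoef1 (out_s1 o n) (in_s1 o n)) (Fcoef2 (out_s1 o n) (in_s1 o n)) i j =
  coef_s1 (plucker (Fcoef1 o n) (Fcoef2 o n)) i j.
Proof.
case: j => [|[|[|[|[|[|[|[|[|j]]]]]]]]] //; case: i => [|[|[|[|[|[|[|[|i]]]]]]]] // _ _ _;
rewrite /plucker /out_s1 /in_s1 /Fcoef1 /Fcoef2 /=; ring.
Qed.

(** Here in_1 = beta1 is onto, and its kernel is the line through (- beta1_2, beta1_1). The volume
    condition selects the vector alpha1' on this line, and the product alpha1' beta1' then
    determines beta1'. *)
Lemma Z1_exists (vol : nat -> C) o n (hN : inN (TV_of o n)) :
  volume_normalized vol -> o 3%N 0%N != 0 \/ o 3%N 1%N != 0 ->
  exists hN' : inN (TV_of (out_s1 o n) (in_s1 o n)), Z1 vol (MkN hN) (MkN hN').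
Proof.
move=> [_ hvol] h3.
have [w0 [w1 hw]] : exists w0 w1 : C, o 3%N 0%N * w0 + o 3%N 1%N * w1 = 1.
  case: h3 => h; [exists (o 3%N 0%N)^-1, 0|exists 0, (o 3%N 1%N)^-1];
    by rewrite mulr0 ?addr0 ?add0r mulfV.
have hN' : inN (TV_of (out_s1 o n) (in_s1 o n)).
  (* The subtracted term is - lambda_1, so the new scalar is lambda_2 + lambda_1. *)
  apply: (@inN_TV_of _ _ _ (lambda2 (TV_of o n) - (n 1%N 3%N * o 3%N 1%N + n 0%N 3%N * o 3%N 0%N))).
  have := inN_in_out hN; rewrite /in_out => e.
  apply: ord22_cases; [move: (e 0%N 0%N isT isT)|move: (e 0%N 1%N isT isT)
    |move: (e 1%N 0%N isT isT)|move: (e 1%N 1%N isT isT)];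
  rewrite /out_s1 /in_s1 /= ?mulr1n ?mulr0n => {}e; rewrite -?e; ring: e.
exists hN'.
(* W is a section of beta1, and h is the retraction of alpha1' that kills W. *)
pose W : 'M[C]_(1 + 1, 1) := \matrix_(i, j) (if i == 0%N :> nat then w0 else w1).
pose h : 'M[C]_(1, 1 + 1) := \matrix_(i, j) (if j == 0%N :> nat then - w1 else w0).
set f := out1 (TV_of (out_s1 o n) (in_s1 o n)); set g := in1 (TV_of o n).
have [|||||x1 x2 x3 x4] := @split_exact _ 1 f W g h; rewrite /f /g ?in1_TV_of ?out1_TV_of.
- apply/matrixP => i j; rewrite !ord1 !mxE !big_ord_recl big_ord0 !mxE /= /in_s1 /=.
  rewrite -hw; ring.
- apply/matrixP => i j; rewrite !ord1 !mxE !big_ord_recl big_ord0 !mxE /= /in_s1 /=.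
  by ring.
- apply/matrixP => i j; rewrite !ord1 !mxE !big_ord_recl big_ord0 !mxE /= /in_s1 /=.
  by ring.
- apply/matrixP => i j; rewrite !ord1 !mxE !big_ord_recl big_ord0 !mxE /= /in_s1 /=.
  by rewrite -hw; ring.
- apply/matrixP => -[[|[|//]] hi] [[|[|//]] hj];
  rewrite !mxE !big_ord_recl !big_ord0 !mxE /= /in_s1 /=; by rewrite -hw; ring.
have edet : \det (row_mx f W) = - 1.
  rewrite /f out1_TV_of (det_row_mx2 (\matrix_(i, j) _) W) !mxE /= /in_s1 /=.
  by rewrite -hw; ring.
split.
- split; apply/matrixP => i j; rewrite /= !mxE /out_s1 /in_s1 ?(ltn_eqF (ltn_ord _)) //.
- by split.
- move=> W' gW'; rewrite x4 // edet /= mul0n expr0 mul1r.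
  by rewrite (hvol 1%N isT) mulrN1.
rewrite /= !in1_TV_of !out1_TV_of /lambda1.
apply/matrixP => -[[|[|//]] hi] [[|[|//]] hj];
rewrite !mxE !big_ord_recl !big_ord0 !mxE /= /out_s1 /in_s1 /=; by ring.
Qed.

End FirstReflection.

(** * The solution of Z_2 where the last two columns of in_2 are independent *)

Section SecondReflection.
Variable R : realType.
Notation C := (R[i]).
Implicit Types o n : nat -> nat -> C.

Definition minor2 n (a b : nat) : C := n 0%N a * n 1%N b - n 0%N b * n 1%N a.

(* Write in_2 = (X | Y) and out_2 = (P; Q) in 2 x 2 blocks, with det Y != 0.  Then
   out_2' = (Y; - Y^-1 X Y), in_2' = Y^-1 (P X - lambda | P Y), and on N one has
   Q = Y^-1 (lambda - X P). *)
Definition pivot_inv n (i j : nat) : C :=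
  (if i == 0%N then (if j == 0%N then n 1%N 3%N else - n 0%N 3%N)
   else if j == 0%N then - n 1%N 2%N else n 0%N 2%N) / minor2 n 2%N 3%N.

Definition pivot_prod n (i j : nat) : C := n i 0%N * n 0 (2 + j)%N + n i 1%N * n 1 (2 + j)%N.

Definition out_s2 n i j : C :=
  if (i < 2)%N then n i (2 + j)%N
  else - (pivot_inv n (i - 2) 0 * pivot_prod n 0%N j + pivot_inv n (i - 2) 1 * pivot_prod n 1%N j).

Definition PN (lam : C) o n i j : C := o i 0%N * n 0%N j + o i 1%N * n 1%N j - lam *+ (i == j).

Definition in_s2 lam o n i j : C :=
  pivot_inv n i 0%N * PN lam o n 0%N j + pivot_inv n i 1%N * PN lam o n 1%N j.

Definition out_low lam o n i j : C :=
  let r a := lam *+ (a == j) - (n a 0%N * o 0%N j + n a 1%N * o 1%N j) in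
  pivot_inv n i 0%N * r 0 + pivot_inv n i 1%N * r 1.

(** The hypothesis reads X P + Y Q = lambda in blocks, and Y is invertible. *)
Lemma out_low_sol lam o n : minor2 n 2%N 3%N != 0 ->
  (forall a b, (a < 2)%N -> (b < 2)%N -> in_out o n a b = lam *+ (a == b)) ->
  forall i j, (i < 2)%N -> (j < 2)%N -> o (2 + i)%N j = out_low lam o n i j.
Proof.
move=> d0 e i j hi hj; move: i hi.
rewrite /out_low -(e 0%N j isT hj) -(e 1%N j isT hj) /in_out /pivot_inv.
by rewrite /minor2 in d0 *; case=> [|[|//]] _ /=; field.
Qed.

(** Replacing Q by its value removes the constraint: what remains are identities of rational
    functions in X, Y, P and lambda. *)
Lemma plucker_s2 lam o n : minor2 n 2%N 3%N != 0 ->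
  (forall a b, (a < 2)%N -> (b < 2)%N -> in_out o n a b = lam *+ (a == b)) ->
  forall i j, (0 < i)%N -> (i < j)%N -> (j <= 8)%N ->
  plucker (Fcoef1 (out_s2 n) (in_s2 lam o n)) (Fcoef2 (out_s2 n) (in_s2 lam o n)) i j =
  coef_s2 (plucker (Fcoef1 o n) (Fcoef2 o n)) i j.
Proof.
move=> d0 e; have q := out_low_sol d0 e.
have q20 : o 2%N 0%N = _ := q 0%N 0%N isT isT.
have q21 : o 2%N 1%N = _ := q 0%N 1%N isT isT.
have q30 : o 3%N 0%N = _ := q 1%N 0%N isT isT.
have q31 : o 3%N 1%N = _ := q 1%N 1%N isT isT.
case=> [|[|[|[|[|[|[|[|i]]]]]]]]; case=> [|[|[|[|[|[|[|[|[|j]]]]]]]]] // _ _ _;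
rewrite /coef_s2 /plucker /Fcoef1 /Fcoef2 [nth]lock /= -lock /= ?(q20, q21, q30, q31)
  /out_s2 /in_s2 /out_low /PN /pivot_prod /pivot_inv /minor2 /= ?(mulr1n, mulr0n);
rewrite /minor2 in d0; by field.
Qed.

(** With upper block Y in out_2', the equation in_2 out_2' = 0 forces the lower block, and the upper
    rows of out_2' in_2' = out_2 in_2 - lambda_2 force in_2'. The volume condition requires an upper
    block of determinant det Y, so Y itself is a choice up to SL_2. *)
Lemma Z2_exists (vol : nat -> C) o n (hN : inN (TV_of o n)) :
  volume_normalized vol -> minor2 n 2%N 3%N != 0 ->
  let lam := lambda2 (TV_of o n) in
  exists hN' : inN (TV_of (out_s2 n) (in_s2 lam o n)), Z2 vol (MkN hN) (MkN hN').
Proof.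
move=> [_ hvol] d0 lam.
have e : forall a b, (a < 2)%N -> (b < 2)%N -> in_out o n a b = lam *+ (a == b) := inN_in_out hN.
have q := out_low_sol d0 e.
have q20 : o 2%N 0%N = _ := q 0%N 0%N isT isT.
have q21 : o 2%N 1%N = _ := q 0%N 1%N isT isT.
have q30 : o 3%N 0%N = _ := q 1%N 0%N isT isT.
have q31 : o 3%N 1%N = _ := q 1%N 1%N isT isT.
have d0' : n 0%N 2%N * n 1%N 3%N - n 0%N 3%N * n 1%N 2%N != 0 by [].
have hN' : inN (TV_of (out_s2 n) (in_s2 lam o n)).
  (* The reflection changes the sign of lambda_2. *)
  apply: (@inN_TV_of _ _ _ (- lam)); apply: ord22_cases;
  by rewrite /in_out /out_s2 /in_s2 /PN /pivot_prod /pivot_inv /minor2 /= ?(mulr1n, mulr0n); field.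
exists hN'.
(* In blocks, W = (0; Y^-1) and h = (Y^-1 | 0). *)
pose W : 'M[C]_(2 + 2, 2) := \matrix_(i, j) (if (i < 2)%N then 0 else pivot_inv n (i - 2) j).
pose h : 'M[C]_(2, 2 + 2) := \matrix_(i, j) (if (j < 2)%N then pivot_inv n i j else 0).
set f := out2 (TV_of (out_s2 n) (in_s2 lam o n)); set g := in2 (TV_of o n).
have [|||||x1 x2 x3 x4] := @split_exact _ 2 f W g h; rewrite /f /g ?in2_TV_of ?out2_TV_of.
- apply/matrixP => -[[|[|//]] hi] [[|[|//]] hj];
  rewrite !mxE !big_ord_recl big_ord0 !mxE /out_s2 /pivot_prod /pivot_inv /minor2 /=; by field.
- apply/matrixP => -[[|[|//]] hi] [[|[|//]] hj];
  rewrite !mxE !big_ord_recl big_ord0 !mxE /out_s2 /pivot_prod /pivot_inv /minor2 /=; by field.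
- apply/matrixP => -[[|[|//]] hi] [[|[|//]] hj];
  rewrite !mxE !big_ord_recl big_ord0 !mxE /out_s2 /pivot_prod /pivot_inv /minor2 /=; by field.
- apply/matrixP => -[[|[|//]] hi] [[|[|//]] hj];
  rewrite !mxE !big_ord_recl big_ord0 !mxE /out_s2 /pivot_prod /pivot_inv /minor2 /=; by field.
- apply/matrixP => -[[|[|[|[|//]]]] hi] [[|[|[|[|//]]]] hj];
  rewrite !mxE !big_ord_recl !big_ord0 !mxE /out_s2 /pivot_prod /pivot_inv /minor2 /=; by field.
(* The matrix is block lower triangular with diagonal blocks Y and Y^-1. *)
have edet : \det (row_mx f W) = 1.
  rewrite -(vsubmxK f) -(vsubmxK W) -block_mxEh.
  have -> : usubmx W = 0 by apply/matrixP => i j; rewrite !mxE /= ltn_ord.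
  rewrite det_lblock !det2 /f out2_TV_of !mxE /out_s2 /pivot_prod /pivot_inv /minor2 /=; by field.
split.
- by split.
- move=> W' gW'; rewrite x4 // edet mulr1 /= (hvol 2%N isT).
  by rewrite -signr_odd /= expr1 mulN1r opprK.
rewrite /= !in2_TV_of !out2_TV_of.
apply/matrixP => -[[|[|[|[|//]]]] hi] [[|[|[|[|//]]]] hj];
rewrite !mxE !big_ord_recl !big_ord0 !mxE -/lam /= ?(q20, q21, q30, q31)
   /in_s2 /out_low /PN /out_s2 /pivot_prod /pivot_inv /minor2 /= ?(mulr1n, mulr0n); by field.
Qed.

End SecondReflection.

(** * Polynomial functions of one variable *)

Section PolynomialFunctions.
Variable F : numFieldType.

Definition polyfun (g : F -> F) := exists q : {poly F}, forall t, g t = q.[t].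

Lemma polyfun_ext g g' : g =1 g' -> polyfun g -> polyfun g'.
Proof. by move=> e [q hq]; exists q => t; rewrite -e. Qed.

Lemma polyfun_cst c : polyfun (fun=> c).
Proof. by exists c%:P => t; rewrite hornerC. Qed.

Lemma polyfun_id : polyfun id.
Proof. by exists 'X => t; rewrite hornerX. Qed.

Lemma polyfunD g g' : polyfun g -> polyfun g' -> polyfun (fun t => g t + g' t).
Proof. by move=> [q hq] [q' hq']; exists (q + q') => t; rewrite hornerD hq hq'. Qed.

Lemma polyfunN g : polyfun g -> polyfun (fun t => - g t).
Proof. by move=> [q hq]; exists (- q) => t; rewrite hornerN hq. Qed.

Lemma polyfunM g g' : polyfun g -> polyfun g' -> polyfun (fun t => g t * g' t).
Proof. by move=> [q hq] [q' hq']; exists (q * q') => t; rewrite hornerM hq hq'. Qed.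

Lemma polyfun_sum (I : Type) (s : seq I) (f : I -> F -> F) :
  (forall i, polyfun (f i)) -> polyfun (fun t => \sum_(i <- s) f i t).
Proof.
move=> h; elim: s => [|i s ih].
  by apply: polyfun_ext (polyfun_cst 0) => t; rewrite big_nil.
by apply: polyfun_ext (polyfunD (h i) ih) => t; rewrite big_cons.
Qed.

Lemma polyfun_prod (I : Type) (s : seq I) (f : I -> F -> F) :
  (forall i, polyfun (f i)) -> polyfun (fun t => \prod_(i <- s) f i t).
Proof.
move=> h; elim: s => [|i s ih].
  by apply: polyfun_ext (polyfun_cst 1) => t; rewrite big_nil.
by apply: polyfun_ext (polyfunM (h i) ih) => t; rewrite big_cons.
Qed.

Lemma polyfunX g k : polyfun g -> polyfun (fun t => g t ^+ k).
Proof. by move=> [q hq]; exists (q ^+ k) => t; rewrite horner_exp hq. Qed.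

Lemma polyfun_meval m (p : {mpoly F[m]}) (v : F -> 'I_m -> F) :
  (forall i, polyfun (v^~ i)) -> polyfun (fun t => p.@[v t]).
Proof.
move=> hv; apply: (@polyfun_ext (fun t => \sum_(d <- msupp p) p@_d * \prod_i v t i ^+ d i)).
  by move=> t; rewrite mevalE.
apply: polyfun_sum => d; apply: polyfunM; first exact: polyfun_cst.
by apply: polyfun_prod => i; apply: polyfunX.
Qed.

Lemma polyfun_eq0 g g' t1 : polyfun g -> polyfun g' -> g' t1 != 0 ->
  (forall t, g' t != 0 -> g t = 0) -> forall t, g t = 0.
Proof.
move=> [q hq] [q' hq'] ne h.
suff /eqP : q * q' = 0.
  rewrite mulf_eq0 => /orP[/eqP q0|/eqP q0]; first by move=> t; rewrite hq q0 horner0.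
  by move: ne; rewrite hq' q0 horner0 eqxx.
apply/eqP; apply/negPn/negP => /max_poly_roots.
(* In characteristic 0 the integers below the size of q * q' are distinct, and they are too many
   roots for a nonzero polynomial. *)
move=> /(_ [seq i%:R | i <- iota 0 (size (q * q'))]).
rewrite size_map size_iota ltnn => hr; suff: false by []; apply: hr; last first.
  by rewrite map_inj_uniq ?iota_uniq // => a b /eqP; rewrite eqr_nat => /eqP.
apply/allP => x _; rewrite rootE hornerM -hq -hq'.
have [->|/h ->] := eqVneq (g' x) 0; by rewrite ?mulr0 ?mul0r.
Qed.

End PolynomialFunctions.

Ltac polyf := repeat first [exact: polyfun_cst | exact: polyfun_id | apply: polyfunD
  | apply: polyfunN | apply: polyfunM].

(** * Polynomial curves in N, and density of the locus where beta1 is nonzero *)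

Section Curves.
Variable R : realType.
Notation C := (R[i]).
Implicit Types o n : nat -> nat -> C.

Lemma polyfun_mxvec a b (A : C -> 'M[C]_(a, b)) :
  (forall i j, polyfun (fun t => A t i j)) -> forall k, polyfun (fun t => mxvec (A t) 0 k).
Proof.
move=> h k; case/mxvec_indexP: k => i j.
by apply: polyfun_ext (h i j) => t; rewrite mxvecE.
Qed.

Lemma polyfun_row_mx a b (A : C -> 'rV[C]_a) (B : C -> 'rV[C]_b) :
  (forall k, polyfun (fun t => A t 0 k)) -> (forall k, polyfun (fun t => B t 0 k)) ->
  forall k, polyfun (fun t => row_mx (A t) (B t) 0 k).
Proof.
move=> hA hB k; case: (split_ordP k) => l ->.
  by apply: polyfun_ext (hA l) => t; rewrite row_mxEl.
by apply: polyfun_ext (hB l) => t; rewrite row_mxEr.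
Qed.

Lemma polyfun_regular (f : N R -> C) (o n : C -> nat -> nat -> C)
    (hN : forall t, inN (TV_of (o t) (n t))) :
  (forall i j, polyfun (fun t => o t i j)) -> (forall i j, polyfun (fun t => n t i j)) ->
  regular f -> polyfun (fun t => f (MkN (hN t))).
Proof.
move=> ho hn [p hp].
apply: (@polyfun_ext _ (fun t => p.@[coordTV (TV_of (o t) (n t)) 0])).
  by move=> t; rewrite hp.
apply: polyfun_meval; apply: polyfun_row_mx; apply: polyfun_row_mx; apply: polyfun_mxvec => i j;
[have h := polyfunN (hn i 3%N)|have h := ho i j|have h := ho 3%N j|have h := hn i j];
by apply: polyfun_ext h => t; rewrite mxE.
Qed.

Lemma regular_congr (f : N R -> C) (B B' : N R) : regular f -> B = B' :> TV R -> f B = f B'.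
Proof. by move=> [p hp] e; rewrite !hp e. Qed.

(** Quantified over the proof of membership in N: the claim is void off N, so density statements can
    range over all o and n. *)
Definition vanishes (f : N R -> C) o n := forall h : inN (TV_of o n), f (MkN h) = 0.

(** The polynomial g records when the curve is known to lie in the vanishing locus. Being nonzero at
    t1, it vanishes at finitely many t only, and f along the curve is a polynomial. *)
Lemma curve_vanish (f : N R -> C) (o n : C -> nat -> nat -> C) g t1 t0 :
  regular f ->
  (forall t, inN (TV_of (o t) (n t))) ->
  (forall i j, polyfun (fun t => o t i j)) -> (forall i j, polyfun (fun t => n t i j)) ->
  polyfun g -> g t1 != 0 -> (forall t, g t != 0 -> vanishes f (o t) (n t)) ->
  vanishes f (o t0) (n t0).
Proof.
move=> rf hN ho hn hg gt1 h h0.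
have pf := polyfun_regular hN ho hn rf.
have := polyfun_eq0 pf hg gt1 (fun t gt => h t gt (hN t)) t0.
by move=> <-; apply: regular_congr rf _.
Qed.

Lemma curve_vanish0 (f : N R -> C) o n (ot nt : C -> nat -> nat -> C) g :
  regular f ->
  (forall i j, ot 0 i j = o i j) -> (forall i j, nt 0 i j = n i j) ->
  (forall t, inN (TV_of (ot t) (nt t))) ->
  (forall i j, polyfun (fun t => ot t i j)) -> (forall i j, polyfun (fun t => nt t i j)) ->
  polyfun g -> g 1 != 0 -> (forall t, g t != 0 -> vanishes f (ot t) (nt t)) ->
  vanishes f o n.
Proof.
move=> rf eo en hN ho hn hg g1 h.
have -> : o = ot 0 by apply/funext => i; apply/funext => j; rewrite eo.
have -> : n = nt 0 by apply/funext => i; apply/funext => j; rewrite en.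
exact: curve_vanish rf hN ho hn hg g1 h.
Qed.

Lemma in_out_inN o n o' n' : inN (TV_of o n) ->
  (forall a b, (a < 2)%N -> (b < 2)%N -> in_out o' n' a b = in_out o n a b) ->
  inN (TV_of o' n').
Proof.
move=> /inN_in_out e h; apply: inN_TV_of => a b ha hb.
by rewrite h // e.
Qed.

Lemma kernel32 n : exists k : nat -> C,
  (exists2 i, (i < 3)%N & k i != 0) /\
  forall a, (a < 2)%N -> n a 0%N * k 0%N + n a 1%N * k 1%N + n a 2%N * k 2%N = 0.
Proof.
pose A : 'M[C]_(3, 2) := \matrix_(i, a) n a i.
have : kermx A != 0.
  rewrite -mxrank_eq0 mxrank_ker subn_eq0 -ltnNge.
  exact: leq_ltn_trans (rank_leq_col A) _.
move=> /rowV0Pn[v /sub_kermxP vA v0].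
exists (fun i => v 0 (inord i)); split.
  have [i vi] : exists i, v 0 i != 0.
    apply/existsP; apply: contraNT v0 => /existsPn h; apply/eqP/rowP => i.
    by rewrite mxE; apply/eqP; have := h i; rewrite negbK.
  by exists i; rewrite ?inord_val.
move=> a ha; have := congr1 (fun M : 'rV_2 => M 0 (Ordinal ha)) vA.
rewrite !mxE !big_ord_recl big_ord0 !mxE /= => e; rewrite -[RHS]e addr0 addrA.
have E i : (i < 3)%N -> forall x : 'I_3, nat_of_ord x = i -> inord i = x.
  by move=> hi x hx; apply: val_inj; rewrite /= inordK // hx.
rewrite (E 0%N isT ord0) // (E 1%N isT (lift ord0 ord0)) //.
rewrite (E 2%N isT (lift ord0 (lift ord0 ord0))) //.
by rewrite /bump /= ![n a _ * _]mulrC.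
Qed.

(* If row i of alpha2 is nonzero, the moment is unchanged when t times that row is
   added to beta1 and t alpha1 is added to column i of beta2.  If not, first make
   alpha2 nonzero by adding to its first column a multiple of a vector killed by beta2. *)
Lemma dense_beta1 (f : N R -> C) : regular f ->
  (forall o n, o 3%N 0%N != 0 \/ o 3%N 1%N != 0 -> vanishes f o n) -> forall o n, vanishes f o n.
Proof.
move=> rf h.
have hA i j o n : (i < 3)%N -> (j < 2)%N -> o i j != 0 -> vanishes f o n.
  move=> hi hj oij h0; move: h0 (h0) => {}h0.
  have [e3|ne] := eqVneq (o 3%N j) 0; last first.
    by apply: h; case: j hj ne {oij} => [|[|//]] _ ne; [left|right].
  apply: (@curve_vanish0 f o n
    (fun t l b => if l == 3%N then o l b + t * o i b else o l b)
    (fun t a k => if k == i then n a k - t * n a 3%N else n a k) (fun t => t * o i j)) => //.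
  - by move=> l b; rewrite mul0r addr0 if_same.
  - by move=> a k; rewrite mul0r subr0 if_same.
  - move=> t; apply: in_out_inN h0 _ => a b _ _; rewrite /in_out.
    by case: i hi {oij e3} => [|[|[|//]]] _ /=; ring.
  - by move=> l b; case: eqP => _; polyf.
  - by move=> a k; case: eqP => _; polyf.
  - by polyf.
  - by rewrite mul1r.
  move=> t ht; apply: h; rewrite /=.
  have : o 3%N j + t * o i j != 0 by rewrite e3 add0r.
  by case: j hj {oij e3 ht} => [|[|//]] _; [left|right].
move=> o n h0; move: h0 (h0) => {}h0.
have [k [[i i3 ki] hk]] := kernel32 n.
have [oi|ne] := eqVneq (o i 0%N) 0; last exact: (@hA i 0%N).
apply: (@curve_vanish0 f o n
    (fun t l b => if (l < 3)%N && (b == 0%N) then o l b + t * k l else o l b) (fun=> n) id) => //.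
- by move=> l b; rewrite mul0r addr0 if_same.
- move=> t; apply: in_out_inN h0 _ => a b ha _; rewrite /in_out /=; case: eqP => _ //.
  rewrite -[RHS]addr0 -[in RHS](mulr0 t) -[in X in _ = _ + t * X](hk a ha).
  by ring.
- by move=> l b; case: (_ && _); polyf.
- by move=> a l; polyf.
- exact: polyfun_id.
- exact: oner_neq0.
move=> t ht; apply: (hA i 0%N) => //=; rewrite i3 oi add0r.
by rewrite mulf_neq0.
Qed.

End Curves.

(** * Density of the locus where the last minor of in_2 is nonzero *)

Section Pivot.
Variable R : realType.
Notation C := (R[i]).
Implicit Types o n : nat -> nat -> C.

(** The left kernel of the 4 x 2 matrix out_2 has dimension at least 2, and two independent rows
    have a nonzero minor. *)
Lemma left_kernel42 o : exists w : nat -> nat -> C,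
  (forall i j, (i < 2)%N -> (j < 2)%N -> in_out o w i j = 0) /\
  exists a b, [/\ (a < 4)%N, (b < 4)%N & minor2 w a b != 0].
Proof.
pose A : 'M[C]_(4, 2) := \matrix_(i, a) o i a.
have rK : (2 <= \rank (kermx A))%N.
  rewrite mxrank_ker -[X in (X <= _)%N]/(4 - 2)%N leq_sub2l //.
  exact: rank_leq_col.
have [W WA rW] : exists2 W : 'M[C]_(2, 4), W *m A = 0 & row_free W.
  (* The first two rows of a basis of the left kernel. *)
  exists (pid_mx 2 *m row_base (kermx A)).
    apply/sub_kermxP; apply: submx_trans (submxMl _ _) _.
    by rewrite eq_row_base.
  by rewrite /row_free mxrankMfree ?row_base_free // rank_pid_mx.
pose w i j := W (inord i) (inord j).
have W0 (v : 'rV[C]_2) : v *m W = 0 -> v = 0.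
  by move=> e; apply: (row_free_inj rW); rewrite e mul0mx.
exists w; split.
  move=> i j hi hj; have := congr1 (fun M : 'M_2 => M (inord i) (Ordinal hj)) WA.
  rewrite !mxE !big_ord_recl big_ord0 !mxE => <-.
  rewrite /in_out /w addr0 !addrA.
  have E k : (k < 4)%N -> forall x : 'I_4, nat_of_ord x = k -> inord k = x.
    by move=> hk x hx; apply: val_inj; rewrite /= inordK // hx.
  by rewrite (E 0%N isT ord0) // (E 1%N isT (lift ord0 ord0)) //
    (E 2%N isT (lift ord0 (lift ord0 ord0))) //
    (E 3%N isT (lift ord0 (lift ord0 (lift ord0 ord0)))).
have [/forallP h|] := boolP [forall a : 'I_4, [forall b : 'I_4, minor2 w a b == 0]]; last first.
  move=> /forallPn[a /forallPn[b hab]].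
  by exists a, b; split.
exfalso.
have h' (a b : 'I_4) : W 0 a * W 1 b = W 0 b * W 1 a.
  have /forallP/(_ b)/eqP := h a; rewrite /minor2 /w !inord_val.
  have -> : inord 0 = 0 :> 'I_2 by apply: val_inj; rewrite /= inordK.
  have -> : inord 1 = 1 :> 'I_2 by apply: val_inj; rewrite /= inordK.
  by move/eqP; rewrite subr_eq0 => /eqP.
have l01 : lift ord0 ord0 = 1 :> 'I_2 by apply: val_inj.
have mulW (v : 'rV[C]_2) a : (v *m W) 0 a = v 0 0 * W 0 a + v 0 1 * W 1 a.
  by rewrite mxE !big_ord_recl big_ord0 addr0 l01.
(* If all minors vanish, the coefficients (W 1 a, - W 0 a) give a relation between the two rows of
   W, so independence makes row 0 zero, which is again a relation. *)
have z0 a : W 0 a = 0.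
  have /W0 e : (\row_j (if j == 0 then W 1 a else - W 0 a)) *m W = 0.
    by apply/rowP => b; rewrite mulW !mxE /= mulNr mulrC h' mulrC subrr.
  have := congr1 (fun v : 'rV_2 => v 0 1) e; rewrite !mxE /= => /eqP.
  by rewrite oppr_eq0 => /eqP.
have /W0 e : (\row_j (if j == 0 then 1 else 0)) *m W = 0.
  by apply/rowP => b; rewrite mulW !mxE /= z0 mulr0 mul0r addr0.
have := congr1 (fun v : 'rV_2 => v 0 0) e; rewrite !mxE /= => /eqP.
by rewrite oner_eq0.
Qed.

(* If in_2 has rank 2, column operations on in_2 and the inverse row operations on
   out_2 move a nonzero minor to the last two columns.  If in_2 has rank at most 1,
   then lambda_2 = 0, and the segment from in_2 to a matrix of rank 2 that kills
   out_2 stays in N. *)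
Lemma dense_pivot (f : N R -> C) : regular f ->
  (forall o n, minor2 n 2%N 3%N != 0 -> vanishes f o n) -> forall o n, vanishes f o n.
Proof.
move=> rf h.
have step a c d : (a < 4)%N -> (c < 4)%N -> a != c -> d != c ->
    (forall o n, minor2 n c d != 0 -> vanishes f o n) ->
    forall o n, minor2 n a d != 0 -> vanishes f o n.
  move=> ha hc ac dc hcd o n had; have [e|ne] := eqVneq (minor2 n c d) 0; last exact: hcd.
  move=> h0; move: h0 (h0) => {}h0.
  (* Adding t times column a to column c adds t times the minor (a, d) to the minor (c, d). *)
  apply: (@curve_vanish0 _ f o n
    (fun t l b => if l == a then o l b - t * o c b else o l b)
    (fun t i k => if k == c then n i k + t * n i a else n i k)
    (fun t => minor2 n c d + t * minor2 n a d)) => [||||||||t ht].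
  - exact: rf.
  - by move=> l b; rewrite mul0r subr0 if_same.
  - by move=> i k; rewrite mul0r addr0 if_same.
  - move=> t; apply: in_out_inN h0 _ => i b _ _; rewrite /in_out.
    case: a ha ac {had} => [|[|[|[|//]]]] _; case: c hc dc {hcd e} => [|[|[|[|//]]]] _ //= _ _;
    by ring.
  - by move=> l b; case: eqP => _; polyf.
  - by move=> i k; case: eqP => _; polyf.
  - by polyf.
  - by rewrite e add0r mul1r.
  apply: hcd; rewrite /minor2 eqxx (negPf dc).
  by apply: contraNneq ht => <-; apply/eqP; rewrite /minor2; ring.
have sym c d : (forall o n, minor2 n c d != 0 -> vanishes f o n) ->
    forall o n, minor2 n d c != 0 -> vanishes f o n.
  move=> hcd o n hdc; apply: hcd; rewrite -oppr_eq0.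
  by apply: contraNneq hdc => <-; apply/eqP; rewrite /minor2; ring.
have h03 := step 0%N 2%N 3%N isT isT isT isT h.
have h13 := step 1%N 2%N 3%N isT isT isT isT h.
have h32 := sym _ _ h.
have h02 := step 0%N 3%N 2%N isT isT isT isT h32.
have h12 := step 1%N 3%N 2%N isT isT isT isT h32.
have h01 := step 0%N 2%N 1%N isT isT isT isT (sym _ _ h12).
have hA a b o n : (a < 4)%N -> (b < 4)%N -> minor2 n a b != 0 -> vanishes f o n.
  have diag c : minor2 n c c = 0 by rewrite /minor2 mulrC subrr.
  case: a => [|[|[|[|//]]]] _; case: b => [|[|[|[|//]]]] _;
  rewrite ?diag ?eqxx //; move: o n {diag};
  [exact: h01|exact: h02|exact: h03|exact: sym h01|exact: h12|exact: h13|exact: sym h02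
  |exact: sym h12|exact: h|exact: sym h03|exact: sym h13|exact: h32].
move=> o n h0; move: h0 (h0) => {}h0.
have [w [wo [a [b [ha hb mab]]]]] := left_kernel42 o.
have [/forallP z|] := boolP [forall i : 'I_4, [forall j : 'I_4, minor2 n i j == 0]]; last first.
  by move=> /forallPn[i /forallPn[j hij]]; apply: (hA i j).
have {}z i j : (i < 4)%N -> (j < 4)%N -> minor2 n i j = 0.
  by move=> hi hj; have /forallP/(_ (Ordinal hj))/eqP := z (Ordinal hi).
have no := inN_in_out h0.
(* The square of lambda_2 is det (in_2 out_2), which the Cauchy-Binet formula expands over the
   minors of in_2, all zero here. *)
have lam0 : lambda2 (TV_of o n) = 0.
  suff /eqP : lambda2 (TV_of o n) ^+ 2 = 0 by rewrite expf_eq0 => /eqP.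
  have := no 0%N 0%N isT isT; have := no 0%N 1%N isT isT.
  have := no 1%N 0%N isT isT; have := no 1%N 1%N isT isT.
  rewrite !mulr1n !mulr0n => e11 e10 e01 e00.
  transitivity (in_out o n 0%N 0 * in_out o n 1%N 1 - in_out o n 0%N 1 * in_out o n 1%N 0).
    by rewrite e11 e10 e01 e00; ring.
  transitivity (\sum_(0 <= j < 4) \sum_(0 <= i < j) minor2 n i j *
      (o i 0%N * o j 1%N - o j 0%N * o i 1%N)).
    by rewrite /in_out /minor2 unlock /=; ring.
  apply: big1_seq => j; rewrite mem_index_iota => /andP[_ /andP[_ j4]].
  apply: big1_seq => i; rewrite mem_index_iota => /andP[_ /andP[_ ij]].
  by rewrite z ?mul0r // (ltn_trans ij).
apply: (@curve_vanish0 _ f o n (fun=> o) (fun t i j => n i j + t * (w i j - n i j))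
   (fun t => minor2 (fun i j => n i j + t * (w i j - n i j)) a b)) => [||||||||t ht].
- exact: rf.
- by [].
- by move=> i j; rewrite mul0r addr0.
- move=> t; apply: in_out_inN h0 _ => i j hi hj.
  have -> : in_out o (fun i j => n i j + t * (w i j - n i j)) i j =
      in_out o n i j + t * (in_out o w i j - in_out o n i j) by rewrite /in_out; ring.
  by rewrite wo // no // lam0 mul0rn subrr mulr0 addr0.
- by move=> i j; polyf.
- by move=> i j; polyf.
- by rewrite /minor2; polyf.
- by rewrite /minor2 !mul1r !addrA !(addrC (n _ _)) !addrK.
exact: hA ha hb ht.
Qed.

End Pivot.

Local Notation pi := Defs.pi.

(** * From the open loci to all points of the quotient *)

Section Assembly.
Variable R : realType.
Notation C := (R[i]).
Notation ew := (ew R).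
Local Opaque Defs.ew.

Lemma ew_span i j : (0 < i)%N -> (i < j)%N -> (j <= 8)%N ->
  ew i j \in <<so8_frame R 1%g>>%VS.
Proof.
have h k : (k < 28)%N -> (frame_of ew)`_k \in <<so8_frame R 1%g>>%VS.
  by move=> hk; rewrite -frame1E; apply: memv_span; apply: mem_nth; rewrite size_tuple.
have hN x : - x \in <<so8_frame R 1%g>>%VS -> x \in <<so8_frame R 1%g>>%VS by rewrite memvN.
have h45 : ew 4 5 \in <<so8_frame R 1%g>>%VS.
  have e : ew 4 5 = - 2^-1 *: (- ew 4 5 *+ 2).
    have e (x : 'M[C]_8) : x = - 2^-1 *: (- x *+ 2).
      by apply/matrixP => ? ?; rewrite !mxE; field.
    exact: e.
  by rewrite e; apply: memvZ; exact: (h 9%N isT).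
have e18 (a b c d : 'M[C]_8) : a = 3^-1 *: ((a - b - c + d) - d + 2 *: (a + c) + (b - c)).
  by apply/matrixP => ? ?; rewrite !mxE; field.
have h18 : ew 1 8 \in <<so8_frame R 1%g>>%VS.
  rewrite (e18 (ew 1 8) (ew 2 7) (ew 3 6) (ew 4 5)); apply: memvZ.
  apply: memvD; last exact: (h 6%N isT).
  apply: memvD; last by apply: memvZ; exact: (h 7%N isT).
  by apply: memvB; [exact: (h 8%N isT)|].
have h36 : ew 3 6 \in <<so8_frame R 1%g>>%VS.
  have e (a b : 'M[C]_8) : b = (a + b) - a by rewrite addrC addKr.
  by rewrite (e (ew 1 8) (ew 3 6)); apply: memvB => //; exact: (h 7%N isT).
have h27 : ew 2 7 \in <<so8_frame R 1%g>>%VS.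
  have e (a b : 'M[C]_8) : a = (a - b) + b by rewrite subrK.
  by rewrite (e (ew 2 7) (ew 3 6)); apply: memvD => //; exact: (h 6%N isT).
move: i j; apply: lt_pair8_ind.
- exact: (h 2%N isT).
- exact: (h 1%N isT).
- exact: (h 19%N isT).
- exact: (h 22%N isT).
- exact: (h 16%N isT).
- exact: (h 17%N isT).
- exact: (h 25%N isT).
- exact: (h 13%N isT).
- exact: (h 14%N isT).
- exact: h45.
- exact: hN (h 10%N isT).
- exact: (h 0%N isT).
- exact: h36.
- exact: (h 23%N isT).
- exact: (h 26%N isT).
- exact: (h 11%N isT).
- exact: h27.
- exact: (h 3%N isT).
- exact: (h 24%N isT).
- exact: (h 27%N isT).
- exact: (h 12%N isT).
- exact: h18.
- exact: (h 20%N isT).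
- exact: hN (h 21%N isT).
- exact: (h 18%N isT).
- exact: (h 15%N isT).
- exact: (h 4%N isT).
- exact: (h 5%N isT).
Qed.

Lemma Phi_span (B : TV R) : Phi B \in <<so8_frame R 1%g>>%VS.
Proof.
have [o [n ->]] := TV_ofP B.
have -> : Phi (TV_of o n) =
    \sum_(2 <= j < 9) \sum_(1 <= i < j) plucker (Fcoef1 o n) (Fcoef2 o n) i j *: ew i j.
  apply/matrixP => k l; rewrite Phi_TV_of wedge_lin8 summxE; apply: eq_bigr => j _.
  by rewrite summxE; apply: eq_bigr => i _; rewrite [RHS]mxE.
rewrite big_seq; apply: memv_suml => j; rewrite mem_index_iota => /andP[_ j9].
rewrite big_seq; apply: memv_suml => i; rewrite mem_index_iota => /andP[i0 ij].
by apply: memvZ; exact: ew_span.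
Qed.

(** For M = Phi B this writes each entry of the image as a combination of the Phi_kl with constant
    coefficients, hence as an element of C[N]^SL_2. *)
Lemma triality_entry s (M : 'M[C]_8) i j :
  triality_act s M i j = \sum_k \sum_l M k l * triality_act s (delta_mx k l) i j.
Proof.
rewrite {1}[M]matrix_sum_delta triality_sum summxE; apply: eq_bigr => k _.
rewrite triality_sum summxE; apply: eq_bigr => l _.
by rewrite trialityZ mxE.
Qed.

(** A point x of the quotient is a character of C[N]^SL_2. Elements of this ring are functions on N,
    so the hypothesis at the points pi B is an equality in the ring, and any character can be
    applied to it. *)
Lemma ident_of_pi (s : 'S_3) (T : quot R -> quot R) : quot_morphism T ->
  (forall B, ident (T (pi B)) = triality_act s (Phi B)) ->
  forall x, ident (T x) = triality_act s (ident x).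
Proof.
move=> [phi hphi] h x; apply/matrixP => i j.
have e : phi (MkCN_SL2 (Phi_CN R i j)) =
    \sum_k \sum_l triality_act s (delta_mx k l) i j *: MkCN_SL2 (Phi_CN R k l).
  apply: val_inj; apply/funext => B.
  have {}h : pi B (phi (MkCN_SL2 (Phi_CN R i j))) = triality_act s (Phi B) i j.
    by rewrite -hphi -h mxE.
  rewrite -[LHS]/(pi B (phi (MkCN_SL2 (Phi_CN R i j)))) h.
  set X := (X in _ = val X B); rewrite -[RHS]/(pi B X) /X.
  rewrite triality_entry linear_sum; apply: eq_bigr => k _.
  rewrite linear_sum; apply: eq_bigr => l _.
  by rewrite linearZ mulrC.
rewrite mxE hphi e triality_entry linear_sum; apply: eq_bigr => k _.
rewrite linear_sum; apply: eq_bigr => l _.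
by rewrite linearZ [in RHS]mxE mulrC.
Qed.

Lemma regular_defect (s : 'S_3) (T : quot R -> quot R) i j : quot_morphism T ->
  regular (fun B : N R => ident (T (pi B)) i j - triality_act s (Phi B) i j).
Proof.
move=> [phi hphi].
have [r _] : regular (fun_of_CN (phi (MkCN_SL2 (Phi_CN R i j)))) /\
     sl2_invariant (fun_of_CN (phi (MkCN_SL2 (Phi_CN R i j)))).
  by have /asboolP := fun_of_CNP (phi (MkCN_SL2 (Phi_CN R i j))).
apply: regularD.
  by apply: regular_ext r => B; rewrite mxE hphi.
apply: regularN; apply: (@regular_ext _ (fun B : N R =>
  \sum_k \sum_l Phi B k l * triality_act s (delta_mx k l) i j)).
  by move=> B; rewrite triality_entry.
apply: regular_sum => k; apply: regular_sum => l; apply: regularM; first exact: regular_Phi.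
exact: regular_cst.
Qed.

Lemma ident_pi_of_dense (T : quot R -> quot R) (s : 'S_3)
    (G : (nat -> nat -> C) -> (nat -> nat -> C) -> Prop) :
  quot_morphism T ->
  (forall f, regular f -> (forall o n, G o n -> vanishes f o n) -> forall o n, vanishes f o n) ->
  (forall o n (h : inN (TV_of o n)), G o n ->
     exists2 B' : N R, T (pi (MkN h)) = pi B' & Phi B' = triality_act s (Phi (TV_of o n))) ->
  forall B : N R, ident (T (pi B)) = triality_act s (Phi B).
Proof.
move=> qT dense hG [B hB]; have [o [n eB]] := TV_ofP B.
apply/matrixP => i j; apply/eqP; rewrite -subr_eq0; apply/eqP.
have rf := regular_defect s i j qT.
have := dense _ rf _ o n; rewrite /vanishes -eB; apply => {o n B hB eB} o n gon h.
have [B' -> e] := hG o n h gon.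
by rewrite ident_pi e subrr.
Qed.

End Assembly.

Theorem theorem5p2 (R : realType) (vol : nat -> R[i])
    (S : 'S_3 -> quot R -> quot R)
    (hvol : volume_normalized vol) (hS : GelfandGraev_action vol S) :
  (forall (sigma : 'S_3) (x : quot R),
      ident (S sigma x) = triality_act sigma (ident x)) /\
  (forall j : 'M[R[i]]_8 -> quot R, inverse_identification j ->
    forall (sigma : 'S_3) (y : 'M[R[i]]_8), Ominbar y ->
      ident (S sigma (j y)) = triality_act sigma y).
Proof.
have [hq h1 hM hZ1 hZ2] := hS.
suff h sigma x : ident (S sigma x) = triality_act sigma (ident x).
  by split=> // j [_ hj] sigma y hy; rewrite h hj.
move: x; apply: ident_of_pi => //.
have hs1 : forall B, ident (S s1 (pi B)) = triality_act s1 (Phi B).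
  apply: ident_pi_of_dense (hq _) (@dense_beta1 R) _ => o n h hG.
  have [h' z] := Z1_exists h hvol hG.
  exists (MkN h'); first exact: hZ1.
  by apply: (@Phi_triality _ _ (@coef_s1 _));
    [exact: sum_lt8_s1|exact: triality_s1_ew|exact: plucker_s1].
have hs2 : forall B, ident (S s2 (pi B)) = triality_act s2 (Phi B).
  apply: ident_pi_of_dense (hq _) (@dense_pivot R) _ => o n h hG.
  have [h' z] := Z2_exists h hvol hG.
  exists (MkN h'); first exact: hZ2.
  apply: (@Phi_triality _ _ (@coef_s2 _)); [exact: sum_lt8_s2|exact: triality_s2_ew|].
  exact: plucker_s2 hG (inN_in_out h).
pose P t := forall B : N R, ident (S t (pi B)) = triality_act t (Phi B).
have P1 : P 1%g by move=> B; rewrite h1 ident_pi triality1 // Phi_span.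
have PM t u : P t -> P u -> P (t * u)%g.
  (* The point S t (pi B) is not given as some pi B', so the claim for u is first extended to all
     points. Both actions apply the left factor of the product first. *)
  move=> ht hu B; rewrite hM (ident_of_pi (hq u) hu) ht trialityM //.
  exact: Phi_span.
have P01 : P (tperm 0 1).
  (* The third transposition is the conjugate of s_1 by s_2. *)
  have -> : tperm 0 1 = (s2 * (s1 * s2))%g.
    have <- : tperm (s2 2) (s2 1) = tperm 0 1 by rewrite [s2 2]tpermR [s2 1]tpermD.
    by rewrite tpermC -tpermJ /conjg tpermV.
  exact: PM hs2 (PM _ _ hs1 hs2).
have Pt x y : P (tperm x y).
  have P10 : P (tperm 1 0) by rewrite tpermC; exact: P01.
  have P20 : P (tperm 2 0) by rewrite tpermC; exact: hs2.
  have P21 : P (tperm 2 1) by rewrite tpermC; exact: hs1.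
  have [-> |->|->] := ord3P x; have [-> |->|->] := ord3P y; rewrite ?tperm1.
  - exact: P1.
  - exact: P01.
  - exact: hs2.
  - exact: P10.
  - exact: P1.
  - exact: hs1.
  - exact: P20.
  - exact: P21.
  - exact: P1.
have [ts -> _] := prod_tpermP sigma.
by apply: (big_ind P P1 PM) => t _; exact: Pt.
Qed.
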